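(* Let $(M^{n},g,T)$ be a compact connected Riemannian spin manifold ($n\geq3$, $T$ a non-trivial 3-form) with $\nabla^{c}T=0$ and positive scalar curvature $\mathrm{Scal}^{g}$, carrying a non-trivial spinor field $\varphi_{0}\in\Gamma(\Sigma)$ such that $$\nabla^{c}_{X}\varphi_{0}=\nabla^{g}_{X}\varphi_{0}+\tfrac14(X\lrcorner T)\cdot\varphi_{0}=0\quad\forall X\in\Gamma(TM),\qquad T\cdot\varphi_{0}=\gamma\varphi_{0}\ \text{ for some }\gamma\in\mathbb{R}\setminus\{0\}.$$ Then $\varphi_{0}$ is a real Killing spinor (with respect to $g$) if and only if the constant eigenvalue $\gamma$ satisfies $\gamma^{2}=\frac{4n}{9(n-1)}\mathrm{Scal}^{g}$. If this is the case, then the Killing number is $\kappa=\frac{3\gamma}{4n}$ and $$(X\lrcorner T)\cdot\varphi_{0}+\frac{3\gamma}{n}X\cdot\varphi_{0}=0\quad\forall X\in\Gamma(TM).$$ For $n\leq 8$, the condition $\gamma^{2}=\frac{4n}{9(n-1)}\mathrm{Scal}^{g}$ is equivalent to $\gamma^{2}=\frac{2n}{9-n}\|T\|^{2}$, and also to $\mathrm{Scal}^{g}=\frac{9(n-1)}{2(9-n)}\|T\|^{2}$; and if this is the case, then $dT\cdot\varphi_{0}=-\frac{3\gamma^{2}(n-3)}{2n}\varphi_{0}$.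
   Context: $\nabla^{g}$ is the Levi-Civita connection; $\nabla^{c}=\nabla^{g}+\frac12T$ is the metric connection with skew torsion $T$, i.e. $g(\nabla^c_XY,Z)=g(\nabla^g_XY,Z)+\frac12T(X,Y,Z)$. $\Sigma$ is the spinor bundle, ''$\cdot$'' is Clifford multiplication with $X\cdot Y+Y\cdot X=-2g(X,Y)$; forms act on $\Sigma$ by Clifford multiplication. $T(X,Y)$ is the vector with $g(T(X,Y),Z)=T(X,Y,Z)$ and $\|T\|^{2}=\frac13\sum_{i<j}g(T(e_{i},e_{j}),T(e_{i},e_{j}))$ for an orthonormal frame $\{e_i\}$. A real Killing spinor with Killing number $\kappa\in\mathbb{R}\setminus\{0\}$ is a spinor field with $\nabla^{g}_{X}\varphi=\kappa X\cdot\varphi$ for all $X$. *)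

(* Defs.v *)
(* Smooth manifolds and the objects on them are given by their components:
   tensors and connections in the charts of a smooth atlas, spinors in local
   trivialisations of the spin frame bundle.  A tangent vector is the row of its
   components in a chart; [delta_mx 0 i] is the i-th coordinate vector. *)
From HB Require Import structures.
From mathcomp Require Import all_boot all_order all_algebra.
From mathcomp Require Import complex.
From mathcomp Require Import boolp classical_sets functions reals topology.
From mathcomp Require Import normedtype derive.

Set Implicit Arguments.
Unset Strict Implicit.
Unset Printing Implicit Defensive.

Import Order.TTheory GRing.Theory Num.Theory numFieldNormedType.Exports.

Local Open Scope classical_set_scope.
Local Open Scope ring_scope.

Section Smooth.
Variables (R : realType) (n : nat).
Implicit Types (U : set 'rV[R]_n) (f : 'rV[R]_n -> R).

Fixpoint Ck (k : nat) U f : Prop :=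
  (forall x, U x -> {for x, continuous f}) /\
  (if k is k'.+1 then
     forall v : 'rV[R]_n,
       (forall x, U x -> derivable f x v) /\ Ck k' U (fun x => 'D_v f x)
   else True).

Definition smooth U f : Prop := forall k, Ck k U f.

Definition csmooth U (f : 'rV[R]_n -> R[i]) : Prop :=
  smooth U (fun x => complex.Re (f x)) /\ smooth U (fun x => complex.Im (f x)).

Definition partial (i : 'I_n) f (y : 'rV[R]_n) : R := 'D_(delta_mx 0 i) f y.

End Smooth.

Record smooth_manifold (R : realType) (n : nat) (M : topologicalType) :=
  SmoothManifold {
  mfd_hausdorff : hausdorff_space M;
  mfd_second_countable : @second_countable M;
  chart : Type;
  cdom : chart -> set M;
  cimg : chart -> set 'rV[R]_n;
  coord : chart -> M -> 'rV[R]_n;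
  param : chart -> 'rV[R]_n -> M;
  cdom_open : forall a, open (cdom a);
  cimg_open : forall a, open (cimg a);
  cdom_cover : forall x, exists a, cdom a x;
  coord_img : forall a x, cdom a x -> cimg a (coord a x);
  param_dom : forall a y, cimg a y -> cdom a (param a y);
  coordK : forall a x, cdom a x -> param a (coord a x) = x;
  paramK : forall a y, cimg a y -> coord a (param a y) = y;
  coord_continuous : forall a x, cdom a x -> {for x, continuous (coord a)};
  param_continuous : forall a y, cimg a y -> {for y, continuous (param a)};
  transition_smooth : forall a b (i : 'I_n),
    smooth [set y | cimg a y /\ cdom b (param a y)]
           (fun y => coord b (param a y) 0 i) }.

(* The components of a tangent vector transform by v |-> v *m jac a b y. *)
Definition jac (R : realType) (n : nat) (M : topologicalType)
    (X : smooth_manifold R n M) (a b : chart X) (y : 'rV[R]_n) : 'M[R]_n :=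
  \matrix_(p, q) partial p (fun z => coord b (param a z) 0 q) y.

Record riemannian_metric (R : realType) (n : nat) (M : topologicalType)
    (X : smooth_manifold R n M) := RiemannianMetric {
  metric :> chart X -> 'rV[R]_n -> 'M[R]_n;
  metric_smooth : forall a p q, smooth (cimg a) (fun y => metric a y p q);
  metric_sym : forall a y, cimg a y -> (metric a y)^T = metric a y;
  metric_pos : forall a y, cimg a y -> forall v : 'rV[R]_n, v != 0 ->
    0 < (v *m metric a y *m v^T) 0 0;
  metric_trans : forall a b x, cdom a x -> cdom b x ->
    metric a (coord a x) =
      jac a b (coord a x) *m metric b (coord b x) *m (jac a b (coord a x))^T }.

Record three_form (R : realType) (n : nat) (M : topologicalType)
    (X : smooth_manifold R n M) := ThreeForm {
  form :> chart X -> 'rV[R]_n -> 'I_n -> 'I_n -> 'I_n -> R;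
  form_smooth : forall a p q r, smooth (cimg a) (fun y => form a y p q r);
  form_alt12 : forall a y, cimg a y ->
    forall p q r, form a y p q r = - form a y q p r;
  form_alt23 : forall a y, cimg a y ->
    forall p q r, form a y p q r = - form a y p r q;
  form_trans : forall a b x, cdom a x -> cdom b x ->
    let J := jac a b (coord a x) in
    forall p q r, form a (coord a x) p q r =
      \sum_p' \sum_q' \sum_r'
        J p p' * J q q' * J r r' * form b (coord b x) p' q' r' }.

Definition form_nontrivial (R : realType) (n : nat) (M : topologicalType)
    (X : smooth_manifold R n M) (T : three_form X) : Prop :=
  exists a y p q r, cimg a y /\ T a y p q r <> 0.

(* [christoffel a y i j k] is the k-th component of nabla_{d_i} d_j. *)
Record connection (R : realType) (n : nat) (M : topologicalType)
    (X : smooth_manifold R n M) := Connection {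
  christoffel :> chart X -> 'rV[R]_n -> 'I_n -> 'I_n -> 'I_n -> R;
  christoffel_smooth : forall a i j k,
    smooth (cimg a) (fun y => christoffel a y i j k);
  christoffel_trans : forall a b x, cdom a x -> cdom b x ->
    let J := jac a b (coord a x) in
    forall i j r,
      \sum_k christoffel a (coord a x) i j k * J k r =
      partial i (fun z => jac a b z j r) (coord a x)
      + \sum_p \sum_q J i p * J j q * christoffel b (coord b x) p q r }.

Definition torsion_free (R : realType) (n : nat) (M : topologicalType)
    (X : smooth_manifold R n M) (D : connection X) : Prop :=
  forall a y, cimg a y -> forall i j k, D a y i j k = D a y j i k.

Definition metric_compatible (R : realType) (n : nat) (M : topologicalType)
    (X : smooth_manifold R n M) (g : riemannian_metric X) (D : connection X) :
    Prop :=
  forall a y, cimg a y -> forall i j k,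
    partial i (fun z => g a z j k) y =
    \sum_l D a y i j l * g a y l k + \sum_l D a y i k l * g a y j l.

Definition levi_civita (R : realType) (n : nat) (M : topologicalType)
    (X : smooth_manifold R n M) (g : riemannian_metric X) (D : connection X) :
    Prop :=
  torsion_free D /\ metric_compatible g D.

Section TensorCalculus.
Variables (R : realType) (n : nat) (M : topologicalType).
Variables (X : smooth_manifold R n M) (g : riemannian_metric X).
Variables (D : connection X) (T : three_form X).
Implicit Types (a : chart X) (y u v w : 'rV[R]_n).

Definition inner a y u v : R := (u *m g a y *m v^T) 0 0.

Definition form_eval a y u v w : R :=
  \sum_p \sum_q \sum_r T a y p q r * u 0 p * v 0 q * w 0 r.

Definition torsion_vector a y u v : 'rV[R]_n :=
  (\row_l form_eval a y u v (delta_mx 0 l)) *m invmx (g a y).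

Definition christoffel_c a y i j k : R :=
  D a y i j k
  + 2^-1 * torsion_vector a y (delta_mx 0 i) (delta_mx 0 j) 0 k.

(* (nabla^c_{d_l} T)(d_p, d_q, d_r) *)
Definition nabla_c_form a y l p q r : R :=
  partial l (fun z => T a z p q r) y
  - \sum_m (christoffel_c a y l p m * T a y m q r
            + christoffel_c a y l q m * T a y p m r
            + christoffel_c a y l r m * T a y p q m).

Definition ext_d a y p q r s : R :=
  partial p (fun z => T a z q r s) y - partial q (fun z => T a z p r s) y
  + partial r (fun z => T a z p q s) y - partial s (fun z => T a z p q r) y.

(* The l-th component of R(d_i, d_j) d_k, where
   R(X, Y) = [nabla_X, nabla_Y] - nabla_[X, Y]. *)
Definition curvature a y i j k l : R :=
  partial i (fun z => D a z j k l) y - partial j (fun z => D a z i k l) y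
  + \sum_m (D a y j k m * D a y i m l - D a y i k m * D a y j m l).

Definition ricci a y j k : R := \sum_i curvature a y i j k i.

Definition scal a y : R := \sum_j \sum_k invmx (g a y) j k * ricci a y j k.

(* nabla_v Y for a vector field Y given by its components in the chart a *)
Definition cov_deriv a (Y : 'rV[R]_n -> 'rV[R]_n) y v : 'rV[R]_n :=
  \row_k ('D_v (fun z => Y z 0 k) y
          + \sum_i \sum_j v 0 i * Y y 0 j * D a y i j k).

End TensorCalculus.

(* The complex spin representation: 2^[n/2] dimensional, with its Hermitian
   product, for which vectors act by skew-Hermitian matrices.  For n odd there
   are two such representations up to equivalence; no choice is made. *)
Record clifford_rep (R : realType) (n : nat) := CliffordRep {
  gam :> 'I_n -> 'M[R[i]]_(2 ^ n./2);
  gam_clifford : forall p q,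
    gam p *m gam q + gam q *m gam p = (- 2 *+ (p == q))%:M;
  gam_skew : forall p, (map_mx (@conjc R) (gam p))^T = - gam p }.

Section CliffordAction.
Variables (R : realType) (n : nat) (c : clifford_rep R n).
Local Notation I := 'I_n.
Local Notation S := 'M[R[i]]_(2 ^ n./2).

(* Clifford action of the exterior form with components w in an orthonormal
   frame. *)
Definition clif1 (w : I -> R) : S := \sum_(p < n) (w p)%:C%C *: c p.

Definition clif2 (w : I -> I -> R) : S :=
  \sum_(p < n) \sum_(q < n | (p < q)%N) (w p q)%:C%C *: (c p *m c q).

Definition clif3 (w : I -> I -> I -> R) : S :=
  \sum_(p < n) \sum_(q < n | (p < q)%N) \sum_(r < n | (q < r)%N)
    (w p q r)%:C%C *: (c p *m c q *m c r).

Definition clif4 (w : I -> I -> I -> I -> R) : S :=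
  \sum_(p < n) \sum_(q < n | (p < q)%N) \sum_(r < n | (q < r)%N) \sum_(s < n | (r < s)%N)
    (w p q r s)%:C%C *: (c p *m c q *m c r *m c s).

(* The image of Spin(n), which acts faithfully on the spin representation:
   products of an even number of unit vectors. *)
Definition spin_group (A : S) : Prop :=
  exists s : seq 'rV[R]_n,
    [/\ ~~ odd (size s),
        (forall v, v \in s -> v *m v^T = 1%:M) &
        A = \big[mulmx/1%:M]_(v <- s) clif1 (fun p => v 0 p)].

End CliffordAction.

Definition chart_image (R : realType) (n : nat) (M : topologicalType)
    (X : smooth_manifold R n M) (a : chart X) (V : set M) : set 'rV[R]_n :=
  [set y | cimg a y /\ V (param a y)].

(* A spin structure, presented by local sections of the spin frame bundle: the
   induced local orthonormal frames (the rows of [frame], in components of the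
   chart [schart j]) and the Spin(n)-valued transition functions, which lift the
   transition matrices of the frames along the double covering
   Spin(n) -> SO(n). *)
Record spin_structure (R : realType) (n : nat) (M : topologicalType)
    (X : smooth_manifold R n M) (g : riemannian_metric X)
    (c : clifford_rep R n) := SpinStructure {
  strv : Type;
  schart : strv -> chart X;
  sdom : strv -> set M;
  frame : strv -> 'rV[R]_n -> 'M[R]_n;
  lift : strv -> strv -> M -> 'M[R[i]]_(2 ^ n./2);
  sdom_open : forall j, open (sdom j);
  sdom_chart : forall j, sdom j `<=` cdom (schart j);
  sdom_cover : forall x, exists j, sdom j x;
  frame_smooth : forall j p q,
    smooth (chart_image (schart j) (sdom j)) (fun y => frame j y p q);
  frame_orthonormal : forall j y, chart_image (schart j) (sdom j) y ->
    frame j y *m g (schart j) y *m (frame j y)^T = 1%:M;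
  lift_spin : forall k j x, sdom k x -> sdom j x -> spin_group c (lift k j x);
  lift_smooth : forall k j p q,
    csmooth (chart_image (schart j) (sdom j `&` sdom k))
            (fun y => lift k j (param (schart j) y) p q);
  lift_cocycle : forall l k j x, sdom l x -> sdom k x -> sdom j x ->
    lift l k x *m lift k j x = lift l j x;
  (* [A] is the transition matrix: e^k_q = sum_p A q p e^j_p. *)
  lift_frame : forall k j x, sdom k x -> sdom j x ->
    exists A : 'M[R]_n,
      frame k (coord (schart k) x) =
        A *m frame j (coord (schart j) x)
          *m jac (schart j) (schart k) (coord (schart j) x) /\
      forall q, c q *m lift k j x = lift k j x *m clif1 c (fun p => A q p) }.

Definition simg (R : realType) (n : nat) (M : topologicalType)
    (X : smooth_manifold R n M) (g : riemannian_metric X)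
    (c : clifford_rep R n) (P : spin_structure g c) (j : strv P) :
    set 'rV[R]_n :=
  chart_image (schart j) (sdom j).

Record spinor_field (R : realType) (n : nat) (M : topologicalType)
    (X : smooth_manifold R n M) (g : riemannian_metric X)
    (c : clifford_rep R n) (P : spin_structure g c) := SpinorField {
  spinor :> strv P -> 'rV[R]_n -> 'cV[R[i]]_(2 ^ n./2);
  spinor_smooth : forall j p, csmooth (simg j) (fun y => spinor j y p 0);
  spinor_trans : forall k j x, sdom k x -> sdom j x ->
    spinor k (coord (schart k) x)
      = lift k j x *m spinor j (coord (schart j) x) }.

Section SpinGeometry.
Variables (R : realType) (n : nat) (M : topologicalType).
Variables (X : smooth_manifold R n M) (g : riemannian_metric X).
Variables (D : connection X) (T : three_form X).
Variables (c : clifford_rep R n) (P : spin_structure g c).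
Implicit Types (phi : spinor_field P) (j : strv P) (y v : 'rV[R]_n).

Local Notation Spinor := 'cV[R[i]]_(2 ^ n./2).

Definition spinor_nontrivial phi : Prop :=
  exists j y, simg j y /\ phi j y <> 0.

Definition vec_cdot j y v (psi : Spinor) : Spinor :=
  clif1 c (fun p => inner g (schart j) y v (row p (frame j y))) *m psi.

(* (v _| T) . psi *)
Definition contr_cdot j y v (psi : Spinor) : Spinor :=
  clif2 c (fun p q => form_eval T (schart j) y v
                        (row p (frame j y)) (row q (frame j y))) *m psi.

Definition form_cdot j y (psi : Spinor) : Spinor :=
  clif3 c (fun p q r => form_eval T (schart j) y (row p (frame j y))
                          (row q (frame j y)) (row r (frame j y))) *m psi.

Definition ext_d_cdot j y (psi : Spinor) : Spinor :=
  let E := frame j y in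
  clif4 c (fun p q r s =>
    \sum_p' \sum_q' \sum_r' \sum_s'
      ext_d T (schart j) y p' q' r' s' * E p p' * E q q' * E r r' * E s s')
  *m psi.

Definition form_normsq j y : R :=
  let e p := row p (frame j y) in
  3^-1 * \sum_(p < n) \sum_(q < n | (p < q)%N)
    inner g (schart j) y (torsion_vector g T (schart j) y (e p) (e q))
                         (torsion_vector g T (schart j) y (e p) (e q)).

Definition spinor_deriv phi j y v : Spinor :=
  \col_k ('D_v (fun z => complex.Re (phi j z k 0)) y
          +i* 'D_v (fun z => complex.Im (phi j z k 0)) y)%C.

(* The lift of D to spinors:
   v(phi) + 1/2 sum_(p < q) g(nabla_v e_p, e_q) e_p . e_q . phi *)
Definition nabla_g phi j y v : Spinor :=
  spinor_deriv phi j y v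
  + 2^-1 *: (clif2 c (fun p q =>
      inner g (schart j) y
        (cov_deriv D (schart j) (fun z => row p (frame j z)) y v)
        (row q (frame j y))) *m phi j y).

Definition nabla_c phi j y v : Spinor :=
  nabla_g phi j y v + 4^-1 *: contr_cdot j y v (phi j y).

Definition killing_spinor (kappa : R) phi : Prop :=
  kappa != 0 /\
  forall j y v, simg j y ->
    nabla_g phi j y v = kappa%:C%C *: vec_cdot j y v (phi j y).

Definition real_killing_spinor phi : Prop :=
  exists kappa : R, killing_spinor kappa phi.

End SpinGeometry.

(* Main.v *)
(* The statement is pointwise.  Differentiating nabla^c phi = 0 and commuting the
   derivatives gives R^c(X, Y) phi = 0.  As T is nabla^c-parallel, R^c is R^g plus
   terms quadratic in T, so contracting sum_(a, b) e_a e_b R^c(e_a, e_b) phi = 0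
   and using T phi = gamma phi yields
     2 Scal^g = 4 gamma^2 - ||T||^2.
   Two identities in the Clifford algebra, with T_a = e_a _| T, namely
     T^2 + sum_a T_a^2 = - 2 ||T||^2  and  sum_a e_a T_a = sum_a T_a e_a = 3 T,
   give, since T_a and e_a act by skew-Hermitian matrices,
     sum_a |T_a phi + (3 gamma / n) e_a phi|^2
       = (2 ||T||^2 + gamma^2 - 9 gamma^2 / n) |phi|^2.
   As nabla^g_X phi = - 1/4 (X _| T) phi, the left-hand side vanishes exactly when
   phi is a Killing spinor, necessarily with Killing number 3 gamma / (4 n).
   Finally |phi| is locally constant, hence phi has no zeros on the connected M,
   and dT = 2 sigma_T acts as sum_a T_a^2 + 3 ||T||^2. *)
Require Import Defs.
From HB Require Import structures.
From mathcomp Require Import all_boot all_order all_algebra.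
From mathcomp Require Import complex.
From mathcomp Require Import boolp classical_sets functions reals topology.
From mathcomp Require Import normedtype derive.
From mathcomp Require Import ring lra zify.
Import Order.TTheory GRing.Theory Num.Theory numFieldNormedType.Exports.
Local Open Scope classical_set_scope.
Local Open Scope ring_scope.
Set Implicit Arguments.
Unset Strict Implicit.
Unset Printing Implicit Defensive.

(** All equivalences pass through one pivot. Let [Q] be the sum of the squared components of T over
    all ordered triples of frame indices, so [Q = 6 ||T||^2]. Every scalar condition is linear in
    gamma^2, Scal^g and [Q]; the relation between these three eliminates Scal^g and leaves
    [3 (9 - n) gamma^2 = n Q]. The bound n <= 8 permits division by 9 - n. The obstacle in the
    curvature step is that R^c in general violates the first Bianchi identity, on which the
    Lichnerowicz cancellation rests. So R^c is split in an orthonormal frame into R^g and pairings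
    of T with itself, and the pairings are summed separately. Conversely, the skewness of R^g in its
    last two slots is read off from that of R^c, whose connection matrices are skew. Parallelism
    trades the derivatives of T for connection terms, and writing the inverse metric as E^T E, with
    E the frame matrix, avoids differentiating an inverse. *)

(** * Matrix entries, exchange of sums and Kronecker deltas *)

Lemma mx_add (K : pzRingType) m n (A B : 'M[K]_(m, n)) i j :
  (A + B) i j = A i j + B i j.
Proof. by rewrite mxE. Qed.
Lemma mx_opp (K : pzRingType) m n (A : 'M[K]_(m, n)) i j : (- A) i j = - A i j.
Proof. by rewrite mxE. Qed.
Lemma mx_scale (K : pzRingType) m n a (A : 'M[K]_(m, n)) i j :
  (a *: A) i j = a * A i j.
Proof. by rewrite mxE. Qed.
Lemma mx_zero (K : pzRingType) m n i j : (0 : 'M[K]_(m, n)) i j = 0.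
Proof. by rewrite mxE. Qed.

Ltac mxlin :=
  let i := fresh "i" in let j := fresh "j" in
  apply/matrixP => i j; rewrite !(mx_add, mx_opp, mx_scale, mx_zero); ring.


Lemma mulmx_addZ_sq (K : comPzRingType) m (x : K) (A C : 'M[K]_m) :
  (A + x *: C) *m (A + x *: C) =
  A *m A + x *: (C *m A + A *m C) + x ^+ 2 *: (C *m C).
Proof.
rewrite mulmxDl !mulmxDr -!scalemxAl -!scalemxAr; mxlin.
Qed.

Lemma scale_lin3 (K : pzRingType) (V : lmodType K) (w h x k y z : K) (v : V) :
  (w + h * x + k * (y - z)) *: v =
  w *: v + h *: (x *: v) + k *: (y *: v - z *: v).
Proof. by rewrite 2!scalerDl -!scalerA scalerBl. Qed.

Lemma exchange_big3 (V : nmodType) n (F : 'I_n -> 'I_n -> 'I_n -> V) :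
  \sum_a \sum_b \sum_q F a b q = \sum_q \sum_a \sum_b F a b q.
Proof.
rewrite [RHS]exchange_big; apply: eq_bigr => a _; exact: exchange_big.
Qed.

Lemma exchange_big4 (V : nmodType) n (F : 'I_n -> 'I_n -> 'I_n -> 'I_n -> V) :
  \sum_a \sum_b \sum_p \sum_q F a b p q = \sum_q \sum_a \sum_b \sum_p F a b p q.
Proof.
rewrite [RHS]exchange_big; apply: eq_bigr => a _; exact: exchange_big3.
Qed.

Lemma sum_delta (K : comPzRingType) (V : lmodType K) n (p : 'I_n)
    (w : 'I_n -> K) (F : 'I_n -> V) :
  \sum_q w q *: ((p == q)%:R *: F q) = w p *: F p.
Proof.
rewrite (bigD1 p) //= eqxx scale1r big1 ?addr0 // => q /negbTE.
by rewrite eq_sym => ->; rewrite scale0r scaler0.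
Qed.

Lemma sum_delta1 (K : comPzRingType) (V : lmodType K) n (p : 'I_n)
    (F : 'I_n -> V) :
  \sum_q (p == q)%:R *: F q = F p.
Proof.
rewrite -[RHS]scale1r -(sum_delta p (fun=> 1)).
by apply: eq_bigr => q _; rewrite scale1r.
Qed.

(** * Clifford algebra *)

Section CliffordAlgebra.
Variables (K : numFieldType) (n N : nat) (c : 'I_n -> 'M[K]_N).
Hypothesis cP : forall p q, c p *m c q + c q *m c p = (- 2 *+ (p == q))%:M.
Implicit Types (p q r s a b : 'I_n).

Lemma cliff_swap p q :
  c p *m c q = - (c q *m c p) - (p == q)%:R *: (2 *: 1%:M).
Proof.
have /(canRL (addrK _)) -> := cP p q.
rewrite addrC; congr (_ + _); rewrite scale_scalar_mx mulr1 scale_scalar_mx.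
by rewrite -raddfN /=; congr (_%:M); rewrite -mulr_natr; ring.
Qed.

Lemma cliff_swapA p q m (Y : 'M[K]_(N, m)) :
  c p *m (c q *m Y) = - (c q *m (c p *m Y)) - (p == q)%:R *: (2 *: Y).
Proof.
by rewrite mulmxA cliff_swap mulmxBl mulNmx -!scalemxAl mul1mx mulmxA.
Qed.

Lemma double_inj m k : injective (fun A : 'M[K]_(m, k) => 2 *: A).
Proof. by apply: scalerI; rewrite pnatr_eq0. Qed.

Lemma cliff_sq p : c p *m c p = - 1%:M.
Proof.
apply: double_inj; rewrite /= scaler_nat mulr2n {1}cliff_swap eqxx scale1r.
mxlin.
Qed.

(** Swapping the two factors and renaming the indices gives Z = - Z - 2 tr(S), so only the trace
    survives. *)
Lemma cliff_sum_sym (S : 'I_n -> 'I_n -> K) : (forall a b, S a b = S b a) ->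
  \sum_a \sum_b S a b *: (c a *m c b) = - (\sum_a S a a) *: 1%:M.
Proof.
move=> hS; set Z := LHS.
have h : Z = - Z - (\sum_a S a a) *: (2 *: 1%:M).
  rewrite {1}/Z; under eq_bigr => a _.
    under eq_bigr => b _ do rewrite cliff_swap scalerBr scalerN.
    rewrite big_split /= !sumrN sum_delta.
    over.
  rewrite big_split /= !sumrN -scaler_suml exchange_big /=; congr (- _ - _).
  by apply: eq_bigr => b _; apply: eq_bigr => a _; rewrite hS.
apply: double_inj; rewrite /= scaler_nat mulr2n {1}h; mxlin.
Qed.

(** Moving a vector past two factors leaves a contraction with each slot, and the two agree because
    [w] is skew. The 4 is the 2 of the Clifford relation times these two slots. *)
Lemma cliff_two_form (w : 'I_n -> 'I_n -> K) b :
  (forall p q, w p q = - w q p) ->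
  c b *m (\sum_p \sum_q w p q *: (c p *m c q)) =
  (\sum_p \sum_q w p q *: (c p *m c q)) *m c b - 4 *: \sum_q w b q *: c q.
Proof.
move=> wC; have h p q : c b *m (c p *m c q) = c p *m c q *m c b
    + (b == q)%:R *: (2 *: c p) - (b == p)%:R *: (2 *: c q).
  rewrite cliff_swapA (cliff_swap b q) mulmxBr mulmxN opprB opprK mulmxA.
  by rewrite -!scalemxAr mulmx1 [X in X - _]addrC.
rewrite mulmx_sumr mulmx_suml.
have -> : \sum_p c b *m (\sum_q w p q *: (c p *m c q)) =
   \sum_p (\sum_q w p q *: (c p *m c q)) *m c b
   + \sum_p w p b *: (2 *: c p) - \sum_p (b == p)%:R *: (2 *: \sum_q w p q *: c q).
  rewrite -big_split -sumrB; apply: eq_bigr => p _ /=.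
  rewrite mulmx_sumr mulmx_suml.
  rewrite -[w p b *: _](sum_delta b (w p) (fun=> 2 *: c p)).
  rewrite !scaler_sumr -big_split -sumrB; apply: eq_bigr => q _ /=.
  rewrite -scalemxAr -scalemxAl h 2!scalerDr; congr (_ + _ + _).
  rewrite scalerN !scalerA.
  by congr (- (_ *: _)); ring.
rewrite sum_delta1.
have -> : \sum_p w p b *: (2 *: c p) = - (2 *: \sum_q w b q *: c q).
  rewrite scaler_sumr -sumrN; apply: eq_bigr => p _.
  by rewrite wC scaleNr !scalerA mulrC.
mxlin.
Qed.

(** Commuting with [X] is a derivation, so the rule for a single vector applies to each factor of
    [c p *m c q]. *)
Lemma comm_two_forms (v w : 'I_n -> 'I_n -> K) :
  (forall p q, v p q = - v q p) ->
  let X := \sum_p \sum_q v p q *: (c p *m c q) in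
  let Y := \sum_p \sum_q w p q *: (c p *m c q) in
  X *m Y = Y *m X + 4 *: \sum_p \sum_q w p q *:
    ((\sum_r v p r *: c r) *m c q + c p *m (\sum_r v q r *: c r)).
Proof.
move=> vC X Y; rewrite /Y mulmx_sumr mulmx_suml scaler_sumr -big_split /=.
apply: eq_bigr => p _.
rewrite mulmx_sumr mulmx_suml scaler_sumr -big_split /=.
apply: eq_bigr => q _.
rewrite -scalemxAr -scalemxAl scalerA mulrC -scalerA -scalerDr; congr (_ *: _).
rewrite -mulmxA (cliff_two_form q vC) mulmxBr -scalemxAr !mulmxA.
rewrite (cliff_two_form p vC) mulmxBl -scalemxAl; mxlin.
Qed.

Section ThreeForm.
Variable t : 'I_n -> 'I_n -> 'I_n -> K.
Hypothesis t12 : forall p q r, t p q r = - t q p r.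
Hypothesis t23 : forall p q r, t p q r = - t p r q.

Lemma alt13 p q r : t p q r = - t r q p.
Proof. by rewrite t12 t23 t12 !opprK. Qed.
Lemma altC p q r : t p q r = t q r p.
Proof. by rewrite t12 t23 opprK. Qed.

(** [L a b] is the vector T(e_a, e_b). As the sums run over all indices, [Q a] is twice the 2-form
    e_a _| T, [S] is six times T, and [nsq] is six times ||T||^2. *)
Let L a b := \sum_q t a b q *: c q.
Let Q a := \sum_p \sum_q t a p q *: (c p *m c q).
Let S := \sum_a c a *m Q a.
Let nsq := \sum_a \sum_b \sum_r t a b r ^+ 2.

Lemma vec_cliffr a b : L b a = - L a b.
Proof. by rewrite /L -sumrN; apply: eq_bigr => q _; rewrite t12 scaleNr. Qed.

Lemma cliff_vec a b p : c p *m L a b = - (L a b *m c p) - (2 * t a b p) *: 1%:M.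
Proof.
rewrite /L mulmx_sumr mulmx_suml.
under eq_bigr => q _ do rewrite -scalemxAr cliff_swap scalerBr scalerN.
rewrite big_split /= !sumrN sum_delta scalerA; congr (- _ - _ *: _); last first.
  by rewrite mulrC.
by apply: eq_bigr => q _; rewrite scalemxAl.
Qed.

Lemma cliff_vecA a b p m (Y : 'M[K]_(N, m)) :
  c p *m (L a b *m Y) = - (L a b *m (c p *m Y)) - (2 * t a b p) *: Y.
Proof. by rewrite mulmxA cliff_vec mulmxBl mulNmx -scalemxAl mul1mx mulmxA. Qed.

Lemma cliff_two a b : c b *m Q a = Q a *m c b - 4 *: L a b.
Proof. exact: cliff_two_form (t23 a). Qed.

Lemma cliff_twoA a b m (Y : 'M[K]_(N, m)) :
  c b *m (Q a *m Y) = Q a *m (c b *m Y) - 4 *: (L a b *m Y).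
Proof. by rewrite mulmxA cliff_two mulmxBl -scalemxAl mulmxA. Qed.

Lemma sum_cliff_vec b : \sum_a c a *m L a b = - Q b.
Proof.
rewrite /Q -sumrN; apply: eq_bigr => a _.
rewrite /L mulmx_sumr -sumrN; apply: eq_bigr => q _.
by rewrite t12 scaleNr mulmxN scalemxAr.
Qed.

Lemma sum_vec_sq : \sum_a \sum_b L a b *m L a b = - nsq *: 1%:M.
Proof.
rewrite /nsq scaleNr scaler_suml -sumrN; apply: eq_bigr => a _.
rewrite scaler_suml -sumrN; apply: eq_bigr => b _.
rewrite /L mulmx_suml -scaleNr -(@cliff_sum_sym (fun r s => t a b r * t a b s)).
  apply: eq_bigr => r _; rewrite mulmx_sumr; apply: eq_bigr => s _.
  by rewrite -scalemxAl -scalemxAr scalerA.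
by move=> r s; rewrite mulrC.
Qed.

Lemma sum_two_cliff : \sum_a Q a *m c a = S.
Proof.
rewrite /S; apply: eq_bigr => a _; rewrite cliff_two.
suff -> : L a a = 0 by rewrite scaler0 subr0.
by apply: double_inj; rewrite /= scaler_nat mulr2n {1}vec_cliffr addNr scaler0.
Qed.

(** The 6 is 4 + 2: passing [Q a] leaves [4 *: \sum_a c a *m L a b], which is -4 [Q b], and passing
    [c a] leaves the diagonal term -2 [Q b]. *)
Lemma cliff_three b : c b *m S = - (S *m c b) - 6 *: Q b.
Proof.
rewrite /S mulmx_sumr mulmx_suml.
under eq_bigr => a _.
  rewrite cliff_swapA cliff_two mulmxBr -scalemxAr opprB mulmxA. over.
rewrite !big_split /= !sumrN -scaler_sumr sum_cliff_vec.
rewrite sum_delta1.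
mxlin.
Qed.

Let QQ := \sum_a Q a *m Q a.

Lemma comm_two a b : Q a *m Q b = Q b *m Q a
  + 4 *: \sum_p \sum_q t b p q *: (L a p *m c q + c p *m L a q).
Proof. exact: comm_two_forms (t23 a). Qed.

(** One half of the sum of [c a *m c b] times the commutator of [Q a] and [Q b], the price of
    reordering in [three_cliff_sq]; [sum_comm3] is the other half. Moving [L a p] to the left past
    [c b] forms the sum of [c a *m L a p], which is - [Q p], and a contraction made of squares of
    vectors. *)
Lemma sum_comm2 : \sum_a \sum_b \sum_p \sum_q
   t b p q *: (c a *m (c b *m (L a p *m c q))) = - QQ - (2 * nsq) *: 1%:M.
Proof.
transitivity (- \sum_p (\sum_a c a *m L a p) *m (\sum_b \sum_q t b p q *: (c b *m c q))
   + 2 *: \sum_b \sum_p L b p *m L b p).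
  have h a b p q : t b p q *: (c a *m (c b *m (L a p *m c q))) =
      - (c a *m L a p *m (t b p q *: (c b *m c q)))
      + 2 *: ((t b p a *: c a) *m (t b p q *: c q)).
    rewrite cliff_vecA (alt13 a p b) mulmxBr mulmxN -!scalemxAr -!scalemxAl.
    rewrite !mulmxA; mxlin.
  transitivity (\sum_a \sum_b \sum_p \sum_q
        - (c a *m L a p *m (t b p q *: (c b *m c q)))
    + \sum_a \sum_b \sum_p \sum_q
        2 *: ((t b p a *: c a) *m (t b p q *: c q))).
    do 4 (rewrite -big_split; apply: eq_bigr => ? _ /=); exact: h.
  congr (_ + _).
    rewrite exchange_big3 -sumrN; apply: eq_bigr => p _.
    rewrite mulmx_suml -sumrN; apply: eq_bigr => a _.
    rewrite (mulmx_sumr (c a *m L a p)) -sumrN; apply: eq_bigr => b _.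
    by rewrite (mulmx_sumr (c a *m L a p)) -sumrN.
  rewrite -exchange_big3 scaler_sumr; apply: eq_bigr => b _.
  rewrite scaler_sumr; apply: eq_bigr => p _.
  rewrite /L mulmx_suml scaler_sumr; apply: eq_bigr => a _.
  by rewrite mulmx_sumr scaler_sumr.
rewrite sum_vec_sq -/QQ.
have -> : \sum_p (\sum_a c a *m L a p) *m (\sum_b \sum_q t b p q *: (c b *m c q)) = QQ.
  apply: eq_bigr => p _; rewrite sum_cliff_vec.
  suff -> : \sum_b \sum_q t b p q *: (c b *m c q) = - Q p.
    by rewrite mulNmx mulmxN opprK.
  rewrite /Q -sumrN; apply: eq_bigr => b _; rewrite -sumrN; apply: eq_bigr => q _.
  by rewrite t12 scaleNr.
mxlin.
Qed.

(** The indices b and p assemble into [Q q]; moving [c a] through it leaves four times the squares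
    of the vectors [L a q]. *)
Lemma sum_comm3 : \sum_a \sum_b \sum_p \sum_q
   t b p q *: (c a *m (c b *m (c p *m L a q))) = - QQ - (4 * nsq) *: 1%:M.
Proof.
transitivity (\sum_q \sum_a c a *m (Q q *m L a q)).
  rewrite exchange_big4.
  apply: eq_bigr => q _; apply: eq_bigr => a _.
  rewrite /Q mulmx_suml mulmx_sumr; apply: eq_bigr => b _.
  rewrite mulmx_suml mulmx_sumr; apply: eq_bigr => p _.
  by rewrite (altC q) -scalemxAl -scalemxAr !mulmxA.
under eq_bigr => q _.
  under eq_bigr => a _ do rewrite cliff_twoA (vec_cliffr a q) mulNmx scalerN opprK.
  rewrite big_split /= -mulmx_sumr sum_cliff_vec mulmxN -scaler_sumr.
  over.
rewrite big_split /= sumrN -scaler_sumr -/QQ.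
rewrite exchange_big /= sum_vec_sq; mxlin.
Qed.

(* The cubic element is [S = sum_a c_a Q_a = sum_a Q_a c_a], so [S^2] can be
   computed by moving [Q_a] across [S] or by moving [c_a] across [S]; adding the
   two results eliminates [sum_(a, b) c_a c_b Q_b Q_a]. *)
Lemma three_cliff_sq : S *m S = - 9 *: QQ - (12 * nsq) *: 1%:M.
Proof.
have e1 : S *m S = \sum_a \sum_b c a *m (c b *m (Q b *m Q a)) + 
   4 *: \sum_a \sum_b \sum_p \sum_q
   t b p q *: (c a *m (c b *m (L a p *m c q)))
  + 4 *: \sum_a \sum_b \sum_p \sum_q
   t b p q *: (c a *m (c b *m (c p *m L a q))) - 4 *: QQ.
  have -> : S *m S = \sum_a \sum_b c a *m (c b *m (Q a *m Q b)) - 4 *: QQ.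
    rewrite {1}/S mulmx_suml.
    under eq_bigr => a _.
      rewrite -mulmxA /S mulmx_sumr.
      under eq_bigr => b _.
        have -> : Q a *m (c b *m Q b) = c b *m (Q a *m Q b) + 4 *: (L a b *m Q b).
          by rewrite cliff_twoA subrK.
        over.
      rewrite big_split /= mulmxDr !mulmx_sumr. over.
    rewrite big_split; congr (_ + _) => /=.
    rewrite exchange_big /= -scalerN; rewrite /QQ scalerN -scaleNr scaler_sumr.
    apply: eq_bigr => b _.
    under eq_bigr => a _ do rewrite -scalemxAr mulmxA.
    by rewrite -scaler_sumr -mulmx_suml sum_cliff_vec mulNmx scalerN scaleNr.
  congr (_ - _); rewrite -addrA -scalerDr -big_split scaler_sumr -big_split.
  apply: eq_bigr => a _ /=.
  rewrite -big_split scaler_sumr -big_split.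
  apply: eq_bigr => b _ /=.
  rewrite comm_two !mulmxDr -2!scalemxAr; congr (_ + _ *: _).
  rewrite !mulmx_sumr -big_split; apply: eq_bigr => p _ /=.
  rewrite !mulmx_sumr -big_split; apply: eq_bigr => q _ /=.
  by rewrite -!scalemxAr !mulmxDr -scalerDr.
have e2 : S *m S = - (\sum_a \sum_b c a *m (c b *m (Q b *m Q a))) - 6 *: QQ.
  rewrite {2}/S mulmx_sumr.
  under eq_bigr => a _.
    rewrite mulmxA.
    have -> : S *m c a = - (c a *m S) - 6 *: Q a.
      by rewrite cliff_three opprB opprK addrAC subrr add0r.
    rewrite mulmxBl mulNmx -scalemxAl -mulmxA mulmx_suml mulmx_sumr. over.
  rewrite big_split /= !sumrN -scaler_sumr; congr (- _ - _).
  by apply: eq_bigr => a _; apply: eq_bigr => b _; rewrite -!mulmxA.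
apply: double_inj; rewrite /= scaler_nat mulr2n {1}e1 e2 sum_comm2 sum_comm3.
mxlin.
Qed.

(** This lemma and the next two treat the three ways of distributing four indices over two copies of
    T contracted in one slot. Both dT and R^c - R^g are combinations of these pairings. *)
Lemma sum_pair12 :
  \sum_p \sum_q \sum_r \sum_s (\sum_m t m p q * t m r s) *:
    (c p *m (c q *m (c r *m c s))) = QQ.
Proof.
transitivity (\sum_m \sum_p \sum_q \sum_r \sum_s (t m p q * t m r s) *:
    (c p *m (c q *m (c r *m c s)))).
  rewrite [RHS]exchange_big; apply: eq_bigr => p _.
  rewrite -exchange_big4; apply: eq_bigr => q _.
  apply: eq_bigr => r _; apply: eq_bigr => s _; exact: scaler_suml.
apply: eq_bigr => m _; rewrite {1}/Q mulmx_suml; apply: eq_bigr => p _.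
rewrite mulmx_suml; apply: eq_bigr => q _.
rewrite /Q mulmx_sumr; apply: eq_bigr => r _.
rewrite mulmx_sumr; apply: eq_bigr => s _.
by rewrite -scalemxAl -scalemxAr scalerA !mulmxA.
Qed.

(** Exchanging the two middle factors reduces this to the previous pairing with a sign; the
    contraction q = r produces the squares of the vectors. *)
Lemma sum_pair13 :
  \sum_p \sum_q \sum_r \sum_s (\sum_m t m p r * t m q s) *:
    (c p *m (c q *m (c r *m c s))) = - QQ - (2 * nsq) *: 1%:M.
Proof.
transitivity (\sum_m \sum_p \sum_q \sum_r \sum_s (t m p r * t m q s) *:
    (c p *m (c q *m (c r *m c s)))).
  rewrite [RHS]exchange_big; apply: eq_bigr => p _.
  rewrite -exchange_big4; apply: eq_bigr => q _.
  apply: eq_bigr => r _; apply: eq_bigr => s _; exact: scaler_suml.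
transitivity (\sum_m (- (Q m *m Q m) + 2 *: \sum_q L m q *m L m q)); last first.
  rewrite big_split /= sumrN -scaler_sumr sum_vec_sq -/QQ; mxlin.
apply: eq_bigr => m _.
have h p q : \sum_r \sum_s (t m p r * t m q s) *: (c p *m (c q *m (c r *m c s)))
   = - (\sum_r \sum_s (t m p r *: (c p *m c r)) *m (t m q s *: (c q *m c s)))
     - 2 *: ((t m p q *: c p) *m L m q).
  rewrite -(sum_delta q (t m p) (fun=> c p)) mulmx_suml scaler_sumr -sumrN -sumrB.
  apply: eq_bigr => r _; rewrite /L mulmx_sumr scaler_sumr -sumrN -sumrB.
  apply: eq_bigr => s _.
  rewrite (cliff_swapA q r) mulmxBr mulmxN -!scalemxAr -!scalemxAl !mulmxA; mxlin.
transitivity (\sum_p \sum_q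
   (- (\sum_r \sum_s (t m p r *: (c p *m c r)) *m (t m q s *: (c q *m c s))))
   + \sum_p \sum_q - (2 *: ((t m p q *: c p) *m L m q))).
  by do 2 (rewrite -big_split; apply: eq_bigr => ? _ /=).
congr (_ + _).
  rewrite /Q mulmx_suml -sumrN; apply: eq_bigr => p _.
  rewrite sumrN exchange_big mulmx_suml; congr (- _); apply: eq_bigr => r _ /=.
  rewrite mulmx_sumr; apply: eq_bigr => q _; by rewrite mulmx_sumr.
rewrite exchange_big scaler_sumr; apply: eq_bigr => q _ /=.
rewrite sumrN -scaler_sumr -mulmx_suml -scalerN -mulNmx; congr (_ *: (_ *m _)).
by rewrite -sumrN; apply: eq_bigr => p _; rewrite t23 scaleNr opprK.
Qed.

(** The inner indices form [Q m] and s forms the vector [L m p]; moving [c p] through [Q m] gives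
    the square of [Q m] up to four vector squares. *)
Lemma sum_pair14 :
  \sum_p \sum_q \sum_r \sum_s (\sum_m t m p s * t m q r) *:
    (c p *m (c q *m (c r *m c s))) = QQ + (4 * nsq) *: 1%:M.
Proof.
transitivity (\sum_m \sum_p \sum_q \sum_r \sum_s (t m p s * t m q r) *:
    (c p *m (c q *m (c r *m c s)))).
  rewrite [RHS]exchange_big; apply: eq_bigr => p _.
  rewrite -exchange_big4; apply: eq_bigr => q _.
  apply: eq_bigr => r _; apply: eq_bigr => s _; exact: scaler_suml.
transitivity (\sum_m (Q m *m Q m - 4 *: \sum_q L m q *m L m q)); last first.
  rewrite big_split /= sumrN -scaler_sumr sum_vec_sq -/QQ; mxlin.
apply: eq_bigr => m _.
have -> : Q m *m Q m = \sum_p Q m *m (c p *m L m p).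
  rewrite -mulmx_sumr; congr (_ *m _); apply: eq_bigr => p _.
  rewrite /L mulmx_sumr; apply: eq_bigr => s _; exact: scalemxAr.
rewrite scaler_sumr -sumrB; apply: eq_bigr => p _; rewrite -cliff_twoA.
rewrite /Q mulmx_suml mulmx_sumr; apply: eq_bigr => q _.
rewrite mulmx_suml mulmx_sumr; apply: eq_bigr => r _.
rewrite /L !mulmx_sumr; apply: eq_bigr => s _.
by rewrite -!scalemxAr -!scalemxAl -!scalemxAr scalerA !mulmxA.
Qed.

End ThreeForm.

(* The sum equals the average of its three cyclic rotations; moving the rotated
   products back to the order [a b p] makes the cubic parts cancel. *)
Lemma cliff_cyc (W : 'I_n -> 'I_n -> 'I_n -> K) :
  (forall a b p, W a b p = - W b a p) ->
  (forall a b p, W a b p + W b p a + W p a b = 0) ->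
  \sum_a \sum_b \sum_p W a b p *: (c a *m (c b *m c p))
    = - (2 *: \sum_a (\sum_b W a b b) *: c a).
Proof.
move=> h12 hc; set X := LHS; set Y := \sum_a _.
have W0 a p : W a a p = 0.
  apply: (@mulfI _ (2 : K)); first by rewrite pnatr_eq0.
  by rewrite mulr0 mulr2n mulrDl !mul1r {1}h12 addNr.
have YE : Y = \sum_a \sum_b W a b b *: c a.
  by apply: eq_bigr => a _; rewrite scaler_suml.
have hX1 : X = \sum_a \sum_b \sum_p W b p a *: (c b *m (c p *m c a)).
  by rewrite /X exchange_big3.
have hX2 : X = \sum_a \sum_b \sum_p W p a b *: (c p *m (c a *m c b)).
  by rewrite hX1 exchange_big3.
have h3 : X + X + X = - (6 *: Y).
  rewrite {1}/X {1}hX1 hX2.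
  transitivity (\sum_a \sum_b \sum_p W b p a *: ((a == b)%:R *: (2 *: c p))
     + (- \sum_a \sum_b \sum_p W b p a *: ((a == p)%:R *: (2 *: c b)))
     + (- \sum_a \sum_b \sum_p W p a b *: ((a == p)%:R *: (2 *: c b)))
     + \sum_a \sum_b \sum_p W p a b *: ((b == p)%:R *: (2 *: c a))).
    rewrite -!sumrN -!big_split; apply: eq_bigr => a _ /=.
    rewrite -!sumrN -!big_split; apply: eq_bigr => b _ /=.
    rewrite -!sumrN -!big_split; apply: eq_bigr => p _ /=.
    have -> : W p a b = - W a b p - W b p a.
      by rewrite -[LHS]subr0 -(hc a b p); ring.
    have -> : c b *m (c p *m c a) = c a *m (c b *m c p)
        + (a == b)%:R *: (2 *: c p) - (a == p)%:R *: (2 *: c b).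
      rewrite (cliff_swap p a) mulmxBr mulmxN (cliff_swapA b a) -!scalemxAr.
      rewrite mulmx1 (eq_sym p a) (eq_sym b a); mxlin.
    have -> : c p *m (c a *m c b) = c a *m (c b *m c p)
        + (b == p)%:R *: (2 *: c a) - (a == p)%:R *: (2 *: c b).
      rewrite (cliff_swapA p a) (cliff_swap p b) mulmxBr mulmxN -!scalemxAr.
      rewrite mulmx1 (eq_sym p a) (eq_sym p b); mxlin.
    mxlin.
  (* The four contractions contribute, with their signs, -2 Y, -2 Y, 0 and -2 Y. *)
  have -> : \sum_a \sum_b \sum_p W b p a *: ((a == b)%:R *: (2 *: c p))
     = - (2 *: Y).
    rewrite YE scaler_sumr -sumrN exchange_big3; apply: eq_bigr => p _.
    rewrite scaler_sumr -sumrN; apply: eq_bigr => a _.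
    by rewrite (sum_delta a (fun b => W b p a)) h12 scaleNr; mxlin.
  have -> : \sum_a \sum_b \sum_p W b p a *: ((a == p)%:R *: (2 *: c b))
     = 2 *: Y.
    rewrite YE scaler_sumr exchange_big; apply: eq_bigr => b _.
    rewrite scaler_sumr; apply: eq_bigr => a _.
    by rewrite (sum_delta a (fun p => W b p a)) scalerA mulrC -scalerA.
  have -> : \sum_a \sum_b \sum_p W p a b *: ((a == p)%:R *: (2 *: c b)) = 0.
    rewrite big1 // => a _; rewrite big1 // => b _.
    by rewrite (sum_delta a (fun p => W p a b)) W0 scale0r.
  have -> : \sum_a \sum_b \sum_p W p a b *: ((b == p)%:R *: (2 *: c a))
     = - (2 *: Y).
    rewrite YE scaler_sumr -sumrN; apply: eq_bigr => a _.
    rewrite scaler_sumr -sumrN; apply: eq_bigr => b _.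
    by rewrite (sum_delta b (fun p => W p a b)) h12 scaleNr; mxlin.
  mxlin.
apply: (@scalerI _ _ (3 : K)); first by rewrite pnatr_eq0.
transitivity (X + X + X); first by mxlin.
rewrite h3; mxlin.
Qed.

(** The algebraic core of the Lichnerowicz formula. By the Bianchi identity only the Ricci
    contraction is left; it is symmetric, so [cliff_sum_sym] reduces it to its trace, the scalar
    curvature. *)
Lemma cliff_curvature (W : 'I_n -> 'I_n -> 'I_n -> 'I_n -> K) :
  (forall a b p q, W a b p q = - W b a p q) ->
  (forall a b p q, W a b p q = - W a b q p) ->
  (forall a b p q, W a b p q + W b p a q + W p a b q = 0) ->
  \sum_a \sum_b \sum_p \sum_q W a b p q *: (c a *m (c b *m (c p *m c q)))
    = (2 * \sum_a \sum_b W a b b a) *: 1%:M.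
Proof.
move=> h12 h34 hc.
have W0 a b p : W a b p p = 0.
  apply: (@mulfI _ (2 : K)); first by rewrite pnatr_eq0.
  by rewrite mulr0 mulr2n mulrDl !mul1r {1}h34 addNr.
transitivity (\sum_q (\sum_a \sum_b \sum_p W a b p q *: (c a *m (c b *m c p))) *m c q).
  rewrite exchange_big4; apply: eq_bigr => q _.
  rewrite mulmx_suml; apply: eq_bigr => a _.
  rewrite mulmx_suml; apply: eq_bigr => b _.
  rewrite mulmx_suml; apply: eq_bigr => p _.
  by rewrite -scalemxAl !mulmxA.
transitivity (- (2 *: \sum_a \sum_q (\sum_b W a b b q) *: (c a *m c q))).
  rewrite exchange_big scaler_sumr -sumrN; apply: eq_bigr => q _.
  rewrite (@cliff_cyc (fun a b p => W a b p q)) // mulNmx -scalemxAl mulmx_suml.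
  congr (- (_ *: _)); apply: eq_bigr => a _; by rewrite -scalemxAl.
rewrite cliff_sum_sym; first by mxlin.
(* Symmetry of the Ricci contraction: in the Bianchi identity for a, b, q with b in the last slot,
   the third term vanishes by skewness. *)
move=> a q; apply: eq_bigr => b _.
have := hc a b q b; rewrite (h34 a b q b) W0 addr0 addrC => /eqP.
rewrite subr_eq0 => /eqP <-.
by rewrite h12 h34 opprK.
Qed.
End CliffordAlgebra.

(** * Sums over all indices against sums over increasing indices *)

Section OrderedSums.
Variables (V : zmodType) (n : nat).
Implicit Types (p q r s : 'I_n).

Lemma sum_lt2 (f : 'I_n -> 'I_n -> V) :
  (forall p q, f p q = f q p) -> (forall p, f p p = 0) ->
  \sum_(p < n) \sum_(q < n) f p q = (\sum_(p < n) \sum_(q < n | (p < q)%N) f p q) *+ 2.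
Proof.
move=> fC f0.
have -> : \sum_(p < n) \sum_(q < n | (p < q)%N) f p q =
    \sum_(p < n) \sum_(q < n) f p q *+ (p < q)%N.
  by apply: eq_bigr => p _; rewrite big_mkcond; apply: eq_bigr => q _; rewrite mulrb.
rewrite mulr2n [X in _ = _ + X]exchange_big -big_split; apply: eq_bigr => p _ /=.
rewrite -big_split; apply: eq_bigr => q _ /=.
have [->|/eqP pq] := eqVneq p q; first by rewrite f0 !mul0rn addr0.
rewrite [f q p]fC -mulrnDr -[LHS]mulr1n; congr (_ *+ _).
have : nat_of_ord p <> q by move=> /val_inj.
by case: (ltngtP p q).
Qed.

(** The factor is 3 * 2: the inner pair is ordered first, and for q < r an index p different from
    both lies in exactly one of three positions. The case of four indices repeats this with 4 *
    6. *)
Lemma sum_lt3 (f : 'I_n -> 'I_n -> 'I_n -> V) :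
  (forall p q r, f p q r = f q p r) -> (forall p q r, f p q r = f p r q) ->
  (forall p q, f p p q = 0) ->
  \sum_(p < n) \sum_(q < n) \sum_(r < n) f p q r =
  (\sum_(p < n) \sum_(q < n | (p < q)%N) \sum_(r < n | (q < r)%N) f p q r) *+ 6.
Proof.
move=> f12 f23 f0.
have -> : \sum_(p < n) \sum_(q < n) \sum_(r < n) f p q r =
    (\sum_(p < n) \sum_(q < n) \sum_(r < n) f p q r *+ (q < r)%N) *+ 2.
  rewrite -sumrMnl; apply: eq_bigr => p _; rewrite sum_lt2 //; last first.
    by move=> q; rewrite f12 f23 f0.
  congr (_ *+ _); apply: eq_bigr => q _; rewrite big_mkcond.
  by apply: eq_bigr => r _; rewrite mulrb.
rewrite -[6%N]/(3 * 2)%N mulrnA; congr (_ *+ _).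
have -> : \sum_(p < n) \sum_(q < n | (p < q)%N) \sum_(r < n | (q < r)%N) f p q r =
    \sum_(p < n) \sum_(q < n) \sum_(r < n) f p q r *+ ((p < q) && (q < r))%N.
  apply: eq_bigr => p _; rewrite big_mkcond; apply: eq_bigr => q _.
  case: ifP => _ /=; last by rewrite big1.
  by rewrite big_mkcond; apply: eq_bigr => r _; rewrite mulrb.
rewrite 2!mulrS mulr1n [X in _ = _ + (X + _)]exchange_big.
rewrite [X in _ = _ + (_ + X)]exchange_big3.
rewrite -!big_split; apply: eq_bigr => p _ /=.
rewrite -!big_split; apply: eq_bigr => q _ /=.
rewrite -!big_split; apply: eq_bigr => r _ /=.
have -> : f q p r = f p q r by [].
have -> : f q r p = f p q r by rewrite f23.
have [->|/eqP pq] := eqVneq p q; first by rewrite f0 !mul0rn !addr0.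
have [->|/eqP pr] := eqVneq p r; first by rewrite f23 f0 !mul0rn !addr0.
rewrite -!mulrnDr; congr (_ *+ _).
have : nat_of_ord p <> q by move=> /val_inj.
have : nat_of_ord p <> r by move=> /val_inj.
lia.
Qed.

Lemma sum_lt4 (f : 'I_n -> 'I_n -> 'I_n -> 'I_n -> V) :
  (forall p q r s, f p q r s = f q p r s) ->
  (forall p q r s, f p q r s = f p r q s) ->
  (forall p q r s, f p q r s = f p q s r) ->
  (forall p q r, f p p q r = 0) ->
  \sum_(p < n) \sum_(q < n) \sum_(r < n) \sum_(s < n) f p q r s =
  (\sum_(p < n) \sum_(q < n | (p < q)%N) \sum_(r < n | (q < r)%N)
     \sum_(s < n | (r < s)%N) f p q r s) *+ 24.
Proof.
move=> f12 f23 f34 f0.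
have -> : \sum_(p < n) \sum_(q < n) \sum_(r < n) \sum_(s < n) f p q r s =
    (\sum_(p < n) \sum_(q < n) \sum_(r < n) \sum_(s < n)
       f p q r s *+ ((q < r) && (r < s))%N) *+ 6.
  rewrite -sumrMnl; apply: eq_bigr => p _; rewrite sum_lt3 //; last first.
    by move=> q r; rewrite f12 f23 f0.
  congr (_ *+ _); apply: eq_bigr => q _; rewrite big_mkcond.
  apply: eq_bigr => r _; case: ifP => _ /=; last by rewrite big1.
  by rewrite big_mkcond; apply: eq_bigr => s _; rewrite mulrb.
rewrite -[24%N]/(4 * 6)%N mulrnA; congr (_ *+ _).
have -> : \sum_(p < n) \sum_(q < n | (p < q)%N) \sum_(r < n | (q < r)%N)
     \sum_(s < n | (r < s)%N) f p q r s =
    \sum_(p < n) \sum_(q < n) \sum_(r < n) \sum_(s < n)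
      f p q r s *+ ((p < q) && ((q < r) && (r < s)))%N.
  apply: eq_bigr => p _; rewrite big_mkcond; apply: eq_bigr => q _.
  case: ifP => _ /=; last by rewrite big1 // => r _; rewrite big1.
  rewrite big_mkcond; apply: eq_bigr => r _.
  case: ifP => _ /=; last by rewrite big1.
  by rewrite big_mkcond; apply: eq_bigr => s _; rewrite mulrb.
rewrite 3!mulrS mulr1n [X in _ = _ + (X + _)]exchange_big.
rewrite [X in _ = _ + (_ + (X + _))]exchange_big3.
rewrite [X in _ = _ + (_ + (_ + X))]exchange_big4.
rewrite -!big_split; apply: eq_bigr => p _ /=.
rewrite -!big_split; apply: eq_bigr => q _ /=.
rewrite -!big_split; apply: eq_bigr => r _ /=.
rewrite -!big_split; apply: eq_bigr => s _ /=.
have -> : f q p r s = f p q r s by [].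
have -> : f q r p s = f p q r s by rewrite f23.
have -> : f q r s p = f p q r s by rewrite f34 f23.
have [->|/eqP pq] := eqVneq p q; first by rewrite f0 !mul0rn !addr0.
have [->|/eqP pr] := eqVneq p r; first by rewrite (f23 r) f0 !mul0rn !addr0.
have [->|/eqP ps] := eqVneq p s.
  by rewrite (f34 s) (f23 s) f0 !mul0rn !addr0.
rewrite -!mulrnDr; congr (_ *+ _).
have : nat_of_ord p <> q by move=> /val_inj.
have : nat_of_ord p <> r by move=> /val_inj.
have : nat_of_ord p <> s by move=> /val_inj.
lia.
Qed.
End OrderedSums.

(** * Forms acting on the spin representation *)

Section CliffordActionSums.
Variables (R : realType) (n : nat) (c : clifford_rep R n).
Local Notation I := 'I_n.
Local Notation rc := (real_complex R).
Implicit Types (p q r s a b : I).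

Lemma cliff_perm p q : c p *m c q + c q *m c p = (- 2 *+ (p == q))%:M.
Proof. exact: gam_clifford. Qed.

Lemma cliff_anti p q : p != q -> c p *m c q = - (c q *m c p).
Proof.
move=> /negbTE pq; rewrite (cliff_swap cliff_perm) pq scale0r subr0 //.
Qed.

Lemma cliff_antiA m p q (Y : 'M_(_, m)) : p != q ->
  c p *m (c q *m Y) = - (c q *m (c p *m Y)).
Proof. by move=> pq; rewrite mulmxA cliff_anti // mulNmx mulmxA. Qed.

Lemma alt_diag (w : I -> I -> R) : (forall p q, w p q = - w q p) ->
  forall p, w p p = 0.
Proof. by move=> h p; have := h p p; lra. Qed.

Lemma clif2_sum (w : I -> I -> R) : (forall p q, w p q = - w q p) ->
  \sum_p \sum_q rc (w p q) *: (c p *m c q) = 2 *: clif2 c w.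
Proof.
move=> h; rewrite sum_lt2 ?scaler_nat // => [p q|p]; last first.
  by rewrite alt_diag // scale0r.
have [->//|pq] := eqVneq p q.
by rewrite h cliff_anti // (rmorphN rc) scaleNr scalerN opprK.
Qed.

Lemma clif3_sum (w : I -> I -> I -> R) :
  (forall p q r, w p q r = - w q p r) -> (forall p q r, w p q r = - w p r q) ->
  \sum_p \sum_q \sum_r rc (w p q r) *: (c p *m (c q *m c r)) = 6 *: clif3 c w.
Proof.
move=> h12 h23.
have h0 q r : w q q r = 0 by have := h12 q q r; lra.
have h0' q r : w q r r = 0 by have := h23 q r r; lra.
rewrite sum_lt3 => [|p q r|p q r|p q]; last by rewrite h0 scale0r.
- rewrite scaler_nat; congr (_ *+ _); rewrite /clif3.
  by do 3 (apply: eq_bigr => ? _); rewrite mulmxA.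
- have [->//|pq] := eqVneq p q.
  by rewrite h12 cliff_antiA // (rmorphN rc) scaleNr scalerN opprK.
have [->//|qr] := eqVneq q r.
by rewrite h23 (cliff_anti qr) (rmorphN rc) scaleNr mulmxN scalerN opprK.
Qed.

Lemma clif4_sum (w : I -> I -> I -> I -> R) :
  (forall p q r s, w p q r s = - w q p r s) ->
  (forall p q r s, w p q r s = - w p r q s) ->
  (forall p q r s, w p q r s = - w p q s r) ->
  \sum_p \sum_q \sum_r \sum_s
    rc (w p q r s) *: (c p *m (c q *m (c r *m c s))) = 24 *: clif4 c w.
Proof.
move=> h12 h23 h34.
have h0 q r s : w q q r s = 0 by have := h12 q q r s; lra.
rewrite sum_lt4 => [|p q r s|p q r s|p q r s|p q r]; last by rewrite h0 scale0r.
- rewrite scaler_nat; congr (_ *+ _); rewrite /clif4.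
  by do 4 (apply: eq_bigr => ? _); rewrite !mulmxA.
- have [->//|pq] := eqVneq p q.
  by rewrite h12 cliff_antiA // (rmorphN rc) scaleNr scalerN opprK.
- have [->//|qr] := eqVneq q r.
  by rewrite h23 (cliff_antiA _ qr) (rmorphN rc) scaleNr mulmxN scalerN opprK.
have [->//|rs] := eqVneq r s.
by rewrite h34 (cliff_anti rs) (rmorphN rc) scaleNr 2!mulmxN scalerN opprK.
Qed.

Section ThreeFormAction.
Variable t : I -> I -> I -> R.
Hypothesis t12 : forall p q r, t p q r = - t q p r.
Hypothesis t23 : forall p q r, t p q r = - t p r q.

Let tc p q r := rc (t p q r).
Let tc12 p q r : tc p q r = - tc q p r.
Proof. by rewrite /tc t12 (rmorphN rc). Qed.
Let tc23 p q r : tc p q r = - tc p r q.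
Proof. by rewrite /tc t23 (rmorphN rc). Qed.

Let T a := clif2 c (t a).
Let nsq := \sum_a \sum_b \sum_r t a b r ^+ 2.

Let TE a : \sum_p \sum_q tc a p q *: (c p *m c q) = 2 *: T a.
Proof. exact: clif2_sum. Qed.

Let TTE : \sum_a (\sum_p \sum_q tc a p q *: (c p *m c q)) *m
    (\sum_p \sum_q tc a p q *: (c p *m c q)) = 4 *: \sum_a T a *m T a.
Proof.
rewrite scaler_sumr; apply: eq_bigr => a _; rewrite !TE.
by rewrite -scalemxAl -scalemxAr scalerA -natrM.
Qed.

Let nsqE : \sum_a \sum_b \sum_r tc a b r ^+ 2 = rc nsq.
Proof.
rewrite /nsq (rmorph_sum rc); apply: eq_bigr => a _.
rewrite (rmorph_sum rc); apply: eq_bigr => b _.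
by rewrite (rmorph_sum rc); apply: eq_bigr => r _; rewrite (rmorphXn rc).
Qed.

Let pairE p q r s : rc (\sum_m t m p q * t m r s) = \sum_m tc m p q * tc m r s.
Proof. by rewrite rmorph_sum; apply: eq_bigr => m _; rewrite rmorphM. Qed.

Lemma sum_cliff_clif2 : \sum_a c a *m T a = 3 *: clif3 c t.
Proof.
apply: double_inj; rewrite /= scalerA -natrM -clif3_sum // scaler_sumr.
apply: eq_bigr => a _; rewrite scalemxAr -TE mulmx_sumr; apply: eq_bigr => p _.
by rewrite mulmx_sumr; apply: eq_bigr => q _; rewrite -scalemxAr.
Qed.

Lemma sum_clif2_cliff : \sum_a T a *m c a = 3 *: clif3 c t.
Proof.
rewrite -sum_cliff_clif2; apply: double_inj; rewrite /= !scaler_sumr.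
under eq_bigr do rewrite scalemxAl -TE.
under [RHS]eq_bigr do rewrite scalemxAr -TE.
exact: (sum_two_cliff cliff_perm tc12 tc23).
Qed.

(** This is [three_cliff_sq] rescaled: [S] is 6 T and [Q a] is 2 T_a, so both sides carry the factor
    36, and 12 [nsq] / 36 is 2 ||T||^2. *)
Lemma clif3_sq :
  clif3 c t *m clif3 c t = - (\sum_a T a *m T a) - rc (nsq / 3) *: 1%:M.
Proof.
have := three_cliff_sq cliff_perm tc12 tc23.
have -> : \sum_a c a *m (\sum_p \sum_q tc a p q *: (c p *m c q)) = 6 *: clif3 c t.
  under eq_bigr do rewrite TE -scalemxAr.
  by rewrite -scaler_sumr sum_cliff_clif2 scalerA -natrM.
rewrite TTE nsqE -scalemxAl -scalemxAr scalerA => h.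
apply: (@scalerI _ _ (6 * 6)); first by rewrite mulf_neq0 ?pnatr_eq0.
rewrite h (rmorphM rc) fmorphV (rmorph_nat rc).
apply/matrixP => i j; rewrite !(mx_add, mx_opp, mx_scale); by field.
Qed.

(** The assumed shape of [w] is that of dT = 2 sigma_T for parallel torsion; the three pairings add
    up to three times the sum of the squares of the [Q a], plus 6 [nsq]. *)
Lemma clif4_pair (w : I -> I -> I -> I -> R) :
  (forall p q r s, w p q r s = 2 * (\sum_m t m p q * t m r s
      - \sum_m t m p r * t m q s + \sum_m t m p s * t m q r)) ->
  clif4 c w = \sum_a T a *m T a + rc (nsq / 2) *: 1%:M.
Proof.
move=> wE; apply: (@scalerI _ _ (24 : R[i])); first by rewrite pnatr_eq0.
have sE (x y : I -> R) : \sum_m x m * y m = \sum_m y m * x m.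
  by apply: eq_bigr => m _; rewrite mulrC.
have s12 p q r s : \sum_m t m p q * t m r s = - \sum_m t m q p * t m r s.
  by rewrite -sumrN; apply: eq_bigr => m _; rewrite t23 mulNr.
have s34 p q r s : \sum_m t m p q * t m r s = - \sum_m t m p q * t m s r.
  by rewrite -sumrN; apply: eq_bigr => m _; rewrite [t m r s]t23 mulrN.
rewrite -clif4_sum; last 3 first.
- move=> p q r s; rewrite !wE (s12 q p) (sE (fun m => t m q r)).
  rewrite (sE (fun m => t m q s)); ring.
- move=> p q r s; rewrite !wE (s34 p s r q); ring.
- by move=> p q r s; rewrite !wE (s34 p q s r); ring.
have e13 := sum_pair13 cliff_perm tc23.
have e12 := sum_pair12 c tc.
have e14 := sum_pair14 cliff_perm tc23.
transitivity (2 *: (\sum_p \sum_q \sum_r \sum_s (\sum_m tc m p q * tc m r s) *: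
    (c p *m (c q *m (c r *m c s))) -
  \sum_p \sum_q \sum_r \sum_s (\sum_m tc m p r * tc m q s) *:
    (c p *m (c q *m (c r *m c s))) +
  \sum_p \sum_q \sum_r \sum_s (\sum_m tc m p s * tc m q r) *:
    (c p *m (c q *m (c r *m c s))))).
  do 4 (rewrite -sumrN -!big_split scaler_sumr; apply: eq_bigr => ? _ /=).
  rewrite wE (rmorphM rc) (rmorph_nat rc) (rmorphD rc) (rmorphB rc).
  by rewrite /= !pairE -scalerA (scalerDl _ (_ - _)) scalerBl.
rewrite e12 e13 e14.
rewrite TTE nsqE (rmorphM rc) fmorphV (rmorph_nat rc).
apply/matrixP => i j; rewrite !(mx_add, mx_opp, mx_scale); by field.
Qed.

(** [O] plays the role of R^c and [W] that of R^g. Only [W] obeys the Bianchi identity, so it goes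
    through [cliff_curvature], while the torsion terms are evaluated as pairings. *)
Lemma cliff_curvature_torsion (W O : I -> I -> I -> I -> R) :
  (forall a b p q, W a b p q = - W b a p q) ->
  (forall a b p q, W a b p q = - W a b q p) ->
  (forall a b p q, W a b p q + W b p a q + W p a b q = 0) ->
  (forall a b p q, O a b p q = W a b p q + 2^-1 * \sum_m t m a b * t m p q
     + 4^-1 * (\sum_m t m a q * t m b p - \sum_m t m a p * t m b q)) ->
  \sum_a \sum_b \sum_p \sum_q
    rc (O a b p q) *: (c a *m (c b *m (c p *m c q)))
  = 4 *: (\sum_a T a *m T a)
    + rc (2 * \sum_a \sum_b W a b b a + 3 / 2 * nsq) *: 1%:M.
Proof.
move=> W12 W34 Wc OE.
have e13 := sum_pair13 cliff_perm tc23.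
have e12 := sum_pair12 c tc.
have e14 := sum_pair14 cliff_perm tc23.
have eW : \sum_a \sum_b \sum_p \sum_q
    rc (W a b p q) *: (c a *m (c b *m (c p *m c q)))
  = (2 * \sum_a \sum_b rc (W a b b a)) *: 1%:M.
  apply: (cliff_curvature cliff_perm (W := fun a b p q => rc (W a b p q))).
  - by move=> a b p q; rewrite W12 (rmorphN rc).
  - by move=> a b p q; rewrite W34 (rmorphN rc).
  - by move=> a b p q; rewrite -!(rmorphD rc) Wc (rmorph0 rc).
have sW : rc (\sum_a \sum_b W a b b a) = \sum_a \sum_b rc (W a b b a).
  by rewrite rmorph_sum; apply: eq_bigr => a _; rewrite rmorph_sum.
transitivity (\sum_a \sum_b \sum_p \sum_q
    rc (W a b p q) *: (c a *m (c b *m (c p *m c q)))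
  + 2^-1 *: (\sum_p \sum_q \sum_r \sum_s (\sum_m tc m p q * tc m r s) *:
    (c p *m (c q *m (c r *m c s)))) +
  4^-1 *: (\sum_p \sum_q \sum_r \sum_s (\sum_m tc m p s * tc m q r) *:
    (c p *m (c q *m (c r *m c s))) -
  \sum_p \sum_q \sum_r \sum_s (\sum_m tc m p r * tc m q s) *:
    (c p *m (c q *m (c r *m c s))))).
  do 4 (rewrite -sumrB !scaler_sumr -!big_split; apply: eq_bigr => ? _ /=).
  rewrite OE !(rmorphD rc) !(rmorphM rc) (rmorphB rc) !fmorphV !(rmorph_nat rc).
  rewrite /= !pairE; exact: scale_lin3.
rewrite eW e12 e13 e14.
rewrite TTE nsqE (rmorphD rc) !(rmorphM rc) fmorphV !(rmorph_nat rc) /= sW.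
apply/matrixP => i j; rewrite !(mx_add, mx_opp, mx_scale); by field.
Qed.

Lemma cliff_sq_sum : \sum_a c a *m c a = - n%:R *: 1%:M.
Proof.
under eq_bigr do rewrite (cliff_sq cliff_perm).
by rewrite sumr_const card_ord scaleNr scaler_nat mulNrn.
Qed.

(** The two orders of the cross term each sum to 3 T, hence the coefficient 6 s. *)
Lemma sum_twistor_sq (s : R) :
  \sum_a (T a + rc s *: c a) *m (T a + rc s *: c a) =
  \sum_a T a *m T a + rc (6 * s) *: clif3 c t - rc (n%:R * s ^+ 2) *: 1%:M.
Proof.
transitivity (\sum_a T a *m T a
  + rc s *: (\sum_a c a *m T a + \sum_a T a *m c a)
  + rc s ^+ 2 *: \sum_a c a *m c a).
  rewrite -big_split !scaler_sumr -!big_split; apply: eq_bigr => a _ /=.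
  exact: mulmx_addZ_sq.
rewrite sum_cliff_clif2 sum_clif2_cliff cliff_sq_sum !(rmorphM rc) !(rmorph_nat rc) /=.
mxlin.
Qed.
End ThreeFormAction.

(** * Hermitian adjoints and positivity *)

Definition adj m k (A : 'M[R[i]]_(m, k)) := (map_mx (@conjc R) A)^T.

Lemma adjM m k l (A : 'M[R[i]]_(m, k)) (B : 'M_(k, l)) :
  adj (A *m B) = adj B *m adj A.
Proof. by rewrite /adj map_mxM trmx_mul. Qed.

Lemma adjN m k (A : 'M[R[i]]_(m, k)) : adj (- A) = - adj A.
Proof. by rewrite /adj raddfN raddfN. Qed.

Lemma adjD m k (A B : 'M[R[i]]_(m, k)) : adj (A + B) = adj A + adj B.
Proof. by rewrite /adj raddfD raddfD. Qed.

Lemma adjZ m k (s : R) (A : 'M[R[i]]_(m, k)) : adj (rc s *: A) = rc s *: adj A.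
Proof.
apply/matrixP => i j; rewrite !mxE rmorphM; congr (_ * _).
exact: conjc_real.
Qed.

Lemma adj_sum m k J (r : seq J) (P : pred J) (A : J -> 'M[R[i]]_(m, k)) :
  adj (\sum_(i <- r | P i) A i) = \sum_(i <- r | P i) adj (A i).
Proof. by rewrite /adj raddf_sum raddf_sum. Qed.

Lemma adj_cliff p : adj (c p) = - c p.
Proof. exact: gam_skew. Qed.

Lemma adj_clif2 (w : I -> I -> R) : adj (clif2 c w) = - clif2 c w.
Proof.
rewrite /clif2 adj_sum -sumrN; apply: eq_bigr => p _.
rewrite adj_sum -sumrN; apply: eq_bigr => q pq.
have qp : q != p by apply: contraTN pq => /eqP ->; rewrite ltnn.
by rewrite adjZ adjM !adj_cliff mulmxN mulNmx opprK (cliff_anti qp) scalerN.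
Qed.

Definition normsq m (phi : 'cV[R[i]]_m) : R :=
  \sum_k (complex.Re (phi k 0) ^+ 2 + complex.Im (phi k 0) ^+ 2).

Lemma normsqE m (phi : 'cV[R[i]]_m) : rc (normsq phi) = (adj phi *m phi) 0 0.
Proof.
rewrite mxE /normsq (rmorph_sum rc); apply: eq_bigr => k _; rewrite !mxE.
case: (phi k 0) => x y /=; apply/eqP; rewrite eq_complex /= !mulNr opprK mulrC.
by apply/andP; split; apply/eqP; ring.
Qed.

Lemma normsq_ge0 m (phi : 'cV[R[i]]_m) : 0 <= normsq phi.
Proof. by apply: sumr_ge0 => k _; rewrite addr_ge0 ?sqr_ge0. Qed.

Lemma normsq_eq0 m (phi : 'cV[R[i]]_m) : normsq phi = 0 -> phi = 0.
Proof.
move=> /eqP; rewrite psumr_eq0; last by move=> k _; rewrite addr_ge0 ?sqr_ge0.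
move=> /allP h; apply/matrixP => k j; rewrite ord1 mxE.
have := h k (mem_index_enum _).
rewrite paddr_eq0 ?sqr_ge0 // !sqrf_eq0 => /andP[/eqP x0 /eqP y0].
by move: x0 y0; case: (phi k 0) => x y /= -> ->.
Qed.

(** Pairing with [phi] turns the sum of squares of skew operators into minus the sum of the |Y_j
    phi|^2. This is how one scalar equation yields an equation for every frame vector. *)
Lemma skew_sq_sum_eq0 (J : finType) m (Y : J -> 'M[R[i]]_m) (phi : 'cV_m) :
  (forall j, adj (Y j) = - Y j) -> (\sum_j Y j *m Y j) *m phi = 0 ->
  forall j, Y j *m phi = 0.
Proof.
move=> Ys Y0.
have : \sum_j normsq (Y j *m phi) = 0.
  apply: (@complexI R); rewrite rmorph_sum rmorph0.
  transitivity ((- (adj phi *m ((\sum_j Y j *m Y j) *m phi))) 0 0); last first.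
    by rewrite Y0 mulmx0 oppr0 mxE.
  rewrite mulmx_suml mulmx_sumr -sumrN summxE; apply: eq_bigr => j _.
  by rewrite [LHS]normsqE adjM Ys mulmxN mulNmx !mulmxA.
move=> /eqP; rewrite psumr_eq0; last by move=> j _; exact: normsq_ge0.
move=> /allP h j; apply: normsq_eq0; apply/eqP; exact: h (mem_index_enum _).
Qed.

End CliffordActionSums.

(** * Calculus in a chart *)

Section Calculus.
Variables (R : realType) (V : normedModType R).
Implicit Types (f : V -> R) (U : set V) (x y u v : V).

Lemma is_derive_line f y v (t : R) : derivable f (y + t *: v) v ->
  is_derive t (1 : R) (fun s => f (y + s *: v)) ('D_v f (y + t *: v)).
Proof.
have e : (fun h : R => h^-1 *: (f (y + (h *: 1 + t) *: v) - f (y + t *: v)))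
  = (fun h : R => h^-1 *: (f (h *: v + (y + t *: v)) - f (y + t *: v))).
  apply/funext => h; congr (_ *: (f _ - _)).
  by rewrite [h *: 1]mulr1 scalerDl addrCA.
move=> df; apply: DeriveDef; first by rewrite /derivable /= e.
by rewrite /derive /= e.
Qed.

Lemma line_MVT f y v (h : R) : 0 < h ->
  (forall t, 0 <= t <= h -> derivable f (y + t *: v) v) ->
  exists2 t, 0 <= t <= h & f (y + h *: v) - f y = h * 'D_v f (y + t *: v).
Proof.
move=> h0 df.
have [||t] := @MVT R (fun s => f (y + s *: v)) (fun s => 'D_v f (y + s *: v)) 0 h h0.
- move=> t; rewrite in_itv /= => /andP[t0 th].
  by apply: is_derive_line; apply: df; rewrite !ltW.
- apply: derivable_within_continuous => t; rewrite in_itv /= => th.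
  by have [] := is_derive_line (df t th).
rewrite in_itv /= => /andP[t0 th]; rewrite scale0r addr0 subr0 mulrC => ->.
by exists t => //; rewrite !ltW.
Qed.

(** The mean value theorem is applied along u to the increment in direction v, and then along v to
    the derivative. The left-hand side is symmetric in u and v, so it compares both mixed
    derivatives. *)
Lemma second_difference f U y u v (h : R) : 0 < h ->
  (forall x, U x -> derivable f x u /\ derivable (fun z => 'D_u f z) x v) ->
  (forall s t, 0 <= s <= h -> 0 <= t <= h -> U (y + s *: u + t *: v)) ->
  exists s t, [/\ 0 <= s <= h, 0 <= t <= h &
    f (y + h *: u + h *: v) - f (y + h *: v) - (f (y + h *: u) - f y) =
    h * (h * 'D_v (fun z => 'D_u f z) (y + s *: u + t *: v))].
Proof.
move=> h0 df Uh.
have hh : 0 <= h <= h by rewrite lexx ltW.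
have h00 : 0 <= (0 : R) <= h by rewrite lexx ltW.
pose F z := f (z + h *: v) - f z.
have dF t : 0 <= t <= h -> is_derive t (1 : R) (fun s => F (y + s *: u))
    ('D_u f (y + t *: u + h *: v) - 'D_u f (y + t *: u)).
  move=> th.
  have d1 := df _ (Uh t h th hh); have d0 := df _ (Uh t 0 th h00).
  rewrite scale0r addr0 in d0.
  have i1 : is_derive t (1 : R) (fun s => f (y + h *: v + s *: u))
      ('D_u f (y + t *: u + h *: v)).
    rewrite addrAC; apply: is_derive_line; rewrite addrAC; exact: d1.1.
  have i0 := is_derive_line d0.1.
  rewrite /F; under eq_fun do rewrite addrAC.
  exact: is_deriveB.
have [||s] := @MVT R (fun s => F (y + s *: u))
  (fun t => 'D_u f (y + t *: u + h *: v) - 'D_u f (y + t *: u)) 0 h h0.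
- move=> t; rewrite in_itv /= => /andP[t0 th]; apply: dF; by rewrite !ltW.
- apply: derivable_within_continuous => t; rewrite in_itv /= => th.
  by have [] := dF t th.
rewrite in_itv /= => /andP[s0 sh]; rewrite scale0r addr0 subr0 mulrC => eF.
have ss : 0 <= s <= h by rewrite !ltW.
have [|t th et] := @line_MVT (fun z => 'D_u f z) (y + s *: u) v h h0.
  by move=> t th; have [] := df _ (Uh s t ss th).
exists s, t; split=> //; rewrite -et -eF /F.
ring.
Qed.

(** The two mixed derivatives are mean values of one second difference, taken at points as close to
    [y] as desired; continuity then bounds their difference at [y] by every e > 0. *)
Lemma derive_comm f U y u v : open U -> U y ->
  (forall w x, U x -> derivable f x w) ->
  (forall w w' x, U x -> derivable (fun z => 'D_w f z) x w') ->
  (forall w w', {for y, continuous (fun x => 'D_w' (fun z => 'D_w f z) x)}) ->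
  'D_u (fun z => 'D_v f z) y = 'D_v (fun z => 'D_u f z) y.
Proof.
move=> oU Uy d1 d2 c2.
apply/eqP; rewrite -subr_eq0 -normr_le0; apply/ler_addgt0Pr => e e0; rewrite add0r.
have e2 : 0 < e / 2 by rewrite divr_gt0.
have /cvgr_dist_lt /(_ _ e2) n1 := c2 v u.
have /cvgr_dist_lt /(_ _ e2) n2 := c2 u v.
have nU : \forall x \near y, U x by exact: open_nbhs_nbhs.
case: ((nbhs_ballP y _).1 (filterI (filterI n1 n2) nU)) => r /= r0 rP.
(* With this [h] the parallelogram spanned by h u and h v at [y] stays inside the ball of radius r;
   the summand 1 keeps the denominator positive when u = v = 0. *)
pose h := r / 2 / (`|u| + `|v| + 1).
have uv : 0 < `|u| + `|v| + 1 by rewrite ltr_wpDl // addr_ge0.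
have h0 : 0 < h by rewrite !divr_gt0.
have inb s t : 0 <= s <= h -> 0 <= t <= h -> ball y r (y + s *: u + t *: v).
  move=> /andP[s0 sh] /andP[t0 th].
  rewrite -ball_normE /ball_ /= -addrA opprD addrA subrr add0r normrN.
  apply: (@le_lt_trans _ _ (h * (`|u| + `|v| + 1))); last first.
    by rewrite /h divfK ?gt_eqF // gtr_pMr // invf_lt1 // ltr1n.
  rewrite (le_trans (ler_normD _ _)) // !normrZ !ger0_norm // 2!mulrDr.
  by rewrite -[X in X <= _]addr0 !lerD // ?ler_wpM2r // mulr1 ltW.
have [s [t [sh th e12]]] := @second_difference f U y u v h h0
  (fun x Ux => conj (d1 u x Ux) (d2 u v x Ux))
  (fun s t hs ht => (rP _ (inb s t hs ht)).2).
have [t' [s' [th' sh' e21]]] := @second_difference f U y v u h h0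
  (fun x Ux => conj (d1 v x Ux) (d2 v u x Ux))
  (fun s t hs ht => (rP _ (eq_ind_r (ball y r) (inb t s ht hs) (addrAC _ _ _))).2).
have : h * (h * 'D_v (fun z => 'D_u f z) (y + s *: u + t *: v))
     = h * (h * 'D_u (fun z => 'D_v f z) (y + t' *: v + s' *: u)).
  apply: etrans (esym e12) (etrans _ e21); rewrite [y + h *: v + _]addrAC.
  by move: (f _) (f _) (f _) (f _) => a b c d; ring.
move=> /(mulfI (lt0r_neq0 h0)) /(mulfI (lt0r_neq0 h0)) eD.
have b1 := (rP _ (inb _ _ sh' th')).1.1; have b2 := (rP _ (inb _ _ sh th)).1.2.
rewrite [y + s' *: u + _]addrAC -eD in b1.
apply: ltW; pose m := 'D_v (fun z => 'D_u f z) (y + s *: u + t *: v).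
apply: le_lt_trans (ler_distD m _ _) _.
by rewrite [e]splitr; apply: ltrD; [exact: b1|rewrite distrC; exact: b2].
Qed.

Lemma derive0_ball f y (r : R) : (forall v x, ball y r x -> is_derive x v f 0) ->
  forall x, ball y r x -> f x = f y.
Proof.
move=> df x xy.
have inb t : 0 <= t <= 1 -> ball y r (y + t *: (x - y)).
  move=> /andP[t0 t1]; move: xy; rewrite -ball_normE /ball_ /=.
  rewrite opprD addrA subrr add0r normrN distrC; apply: le_lt_trans.
  by rewrite normrZ ger0_norm // ler_piMl.
have [|t th] := @line_MVT f y (x - y) 1 ltr01.
  by move=> t th; have [] := df (x - y) _ (inb t th).
have [_ ->] := df (x - y) _ (inb t th).
by rewrite scale1r [y + _]addrC subrK mul1r => /eqP; rewrite subr_eq0 => /eqP.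
Qed.
End Calculus.

(** * Leibniz rules for matrices, common to real and complex entries *)

Section DerivationMx.
(* [der f d]: [f] has derivative [d] at the point [y] in a fixed direction. *)
Variables (T : Type) (K : comPzRingType) (y : T) (der : (T -> K) -> K -> Prop).
Hypothesis derC : forall k, der (fun=> k) 0.
Hypothesis derD : forall f df g dg,
  der f df -> der g dg -> der (fun z => f z + g z) (df + dg).
Hypothesis derM : forall f df g dg,
  der f df -> der g dg -> der (fun z => f z * g z) (df * g y + f y * dg).

Definition mder m k (F : T -> 'M[K]_(m, k)) (F' : 'M[K]_(m, k)) : Prop :=
  forall i j, der (fun z => F z i j) (F' i j).

Lemma der_sum (I : Type) (r : seq I) (P : pred I) (f : I -> T -> K) (df : I -> K) :
  (forall i, der (f i) (df i)) ->
  der (fun z => \sum_(i <- r | P i) f i z) (\sum_(i <- r | P i) df i).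
Proof.
move=> h; elim: r => [|i r ih].
  by rewrite big_nil; under eq_fun do rewrite big_nil; exact: derC.
rewrite big_cons; under eq_fun do rewrite big_cons.
by case: (P i) => //; exact: derD.
Qed.

Lemma mderC m k (A : 'M[K]_(m, k)) : mder (fun=> A) 0.
Proof. by move=> i j; rewrite mxE; exact: derC. Qed.

Lemma mderD m k (F G : T -> 'M[K]_(m, k)) F' G' :
  mder F F' -> mder G G' -> mder (fun z => F z + G z) (F' + G').
Proof.
move=> hF hG i j; rewrite mxE; under eq_fun do rewrite mxE; exact: derD.
Qed.

Lemma mderM m k l (F : T -> 'M[K]_(m, k)) (G : T -> 'M[K]_(k, l)) F' G' :
  mder F F' -> mder G G' -> mder (fun z => F z *m G z) (F' *m G y + F y *m G').
Proof.
move=> hF hG i j; rewrite !mxE -big_split.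
under eq_fun do rewrite mxE.
by apply: der_sum => r; exact: derM.
Qed.

Lemma mderT m k (F : T -> 'M[K]_(m, k)) F' :
  mder F F' -> mder (fun z => (F z)^T) F'^T.
Proof. by move=> hF i j; rewrite mxE; under eq_fun do rewrite mxE; exact: hF. Qed.

Lemma mderZ m k (f : T -> K) df (F : T -> 'M[K]_(m, k)) F' :
  der f df -> mder F F' -> mder (fun z => f z *: F z) (df *: F y + f y *: F').
Proof.
move=> hf hF i j; rewrite !mxE; under eq_fun do rewrite mxE; exact: derM.
Qed.

Lemma mderZl m k (a : K) (F : T -> 'M[K]_(m, k)) F' :
  mder F F' -> mder (fun z => a *: F z) (a *: F').
Proof. by move=> hF; have := mderZ (derC a) hF; rewrite scale0r add0r. Qed.

Lemma mderZr m k (f : T -> K) df (A : 'M[K]_(m, k)) :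
  der f df -> mder (fun z => f z *: A) (df *: A).
Proof. by move=> hf; have := mderZ hf (mderC A); rewrite scaler0 addr0. Qed.

Lemma mder_sum m k (I : Type) (r : seq I) (P : pred I)
    (F : I -> T -> 'M[K]_(m, k)) F' :
  (forall i, mder (F i) (F' i)) ->
  mder (fun z => \sum_(i <- r | P i) F i z) (\sum_(i <- r | P i) F' i).
Proof.
move=> h i j; rewrite summxE; under eq_fun do rewrite summxE.
by apply: der_sum => l; exact: h.
Qed.
End DerivationMx.

Section RealComplexDerivatives.
Variables (R : realType) (n : nat).
Local Notation V := 'rV[R]_n.
Implicit Types (y v : V) (U : set V) (k : 'I_n).

Lemma is_deriveC y v (a : R) : is_derive y v (fun=> a) 0.
Proof. exact: is_derive_cst. Qed.

Lemma is_deriveDf y v (f g : V -> R) df dg : is_derive y v f df ->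
  is_derive y v g dg -> is_derive y v (fun z => f z + g z) (df + dg).
Proof. exact: is_deriveD. Qed.

Lemma is_deriveMf y v (f g : V -> R) df dg : is_derive y v f df ->
  is_derive y v g dg -> is_derive y v (fun z => f z * g z) (df * g y + f y * dg).
Proof.
move=> hf hg; apply: is_derive_eq (is_deriveM hf hg) _.
by rewrite addrC [_ *: df]mulrC.
Qed.

Definition cder y v (f : V -> R[i]) (d : R[i]) : Prop :=
  is_derive y v (fun z => complex.Re (f z)) (complex.Re d) /\
  is_derive y v (fun z => complex.Im (f z)) (complex.Im d).

Lemma cderC y v (a : R[i]) : cder y v (fun=> a) 0.
Proof. by split; exact: is_deriveC. Qed.

Lemma ReD (x z : R[i]) : complex.Re (x + z) = complex.Re x + complex.Re z.
Proof. by case: x z => [a b] [a' b']. Qed.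

Lemma ImD (x z : R[i]) : complex.Im (x + z) = complex.Im x + complex.Im z.
Proof. by case: x z => [a b] [a' b']. Qed.

Lemma cderD y v f g df dg : cder y v f df -> cder y v g dg ->
  cder y v (fun z => f z + g z) (df + dg).
Proof.
move=> [f1 f2] [g1 g2]; split.
  by rewrite ReD; under eq_fun do rewrite ReD; exact: is_deriveDf.
by rewrite ImD; under eq_fun do rewrite ImD; exact: is_deriveDf.
Qed.

Lemma ReM (x z : R[i]) : complex.Re (x * z) =
  complex.Re x * complex.Re z - complex.Im x * complex.Im z.
Proof. by case: x z => [a b] [a' b']. Qed.

Lemma ImM (x z : R[i]) : complex.Im (x * z) =
  complex.Re x * complex.Im z + complex.Im x * complex.Re z.
Proof. by case: x z => [a b] [a' b'] /=. Qed.

Lemma cderM y v f g df dg : cder y v f df -> cder y v g dg ->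
  cder y v (fun z => f z * g z) (df * g y + f y * dg).
Proof.
move=> [f1 f2] [g1 g2]; split.
  under eq_fun do rewrite ReM.
  apply: is_derive_eq (is_deriveB (is_deriveMf f1 g1) (is_deriveMf f2 g2)) _.
  rewrite ReD !ReM; ring.
under eq_fun do rewrite ImM.
apply: is_derive_eq (is_deriveDf (is_deriveMf f1 g2) (is_deriveMf f2 g1)) _.
rewrite ImD !ImM; ring.
Qed.

Lemma cder_real y v (f : V -> R) df : is_derive y v f df ->
  cder y v (fun z => (f z)%:C%C) df%:C%C.
Proof. by move=> hf; split=> //=; exact: is_deriveC. Qed.

(** The relations [rmd] and [cmd] carry differentiability along with the value, so Leibniz rules
    compose without side conditions; [pd] and [cpd] are the derivatives as functions, which can be
    differentiated again. *)
Definition rmd m l k y := @mder V R (is_derive y (delta_mx 0 k)) m l.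
Definition cmd m l v y := @mder V R[i] (cder y v) m l.

Definition pd m l (F : V -> 'M[R]_(m, l)) k y : 'M[R]_(m, l) :=
  \matrix_(i, j) partial k (fun z => F z i j) y.

Definition cpd m l (F : V -> 'M[R[i]]_(m, l)) v y : 'M[R[i]]_(m, l) :=
  \matrix_(i, j) ('D_v (fun z => complex.Re (F z i j)) y
    +i* 'D_v (fun z => complex.Im (F z i j)) y)%C.

Lemma rmdC m l k y (A : 'M[R]_(m, l)) : rmd k y (fun=> A) 0.
Proof. exact: (mderC (@is_deriveC _ _)). Qed.

Lemma rmdD m l k y (F G : V -> 'M[R]_(m, l)) F' G' :
  rmd k y F F' -> rmd k y G G' -> rmd k y (fun z => F z + G z) (F' + G').
Proof. by move=> hF hG; apply: (mderD _ hF hG) => *; exact: is_deriveDf. Qed.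

Lemma rmdM m l p k y (F : V -> 'M[R]_(m, l)) (G : V -> 'M[R]_(l, p)) F' G' :
  rmd k y F F' -> rmd k y G G' ->
  rmd k y (fun z => F z *m G z) (F' *m G y + F y *m G').
Proof. by move=> hF hG; apply: (mderM _ _ _ hF hG) => *;
  first [exact: is_deriveC|exact: is_deriveDf|exact: is_deriveMf]. Qed.

Lemma rmdT m l k y (F : V -> 'M[R]_(m, l)) F' :
  rmd k y F F' -> rmd k y (fun z => (F z)^T) F'^T.
Proof. exact: mderT. Qed.

Lemma rmdZ m l k y a (F : V -> 'M[R]_(m, l)) F' :
  rmd k y F F' -> rmd k y (fun z => a *: F z) (a *: F').
Proof.
by move=> hF; apply: (mderZl _ _ _ hF) => *;
  first [exact: is_deriveC|exact: is_deriveMf].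
Qed.

Lemma cmdM m l p v y (F : V -> 'M[R[i]]_(m, l)) (G : V -> 'M[R[i]]_(l, p)) F' G' :
  cmd v y F F' -> cmd v y G G' ->
  cmd v y (fun z => F z *m G z) (F' *m G y + F y *m G').
Proof. by move=> hF hG; apply: (mderM _ _ _ hF hG) => *;
  first [exact: cderC|exact: cderD|exact: cderM]. Qed.

Lemma cmdZ m l v y a (F : V -> 'M[R[i]]_(m, l)) F' :
  cmd v y F F' -> cmd v y (fun z => a *: F z) (a *: F').
Proof.
by move=> hF; apply: (mderZl _ _ _ hF) => *;
  first [exact: cderC|exact: cderM].
Qed.

Lemma cmdZr m l v y (f : V -> R[i]) df (A : 'M[R[i]]_(m, l)) :
  cder y v f df -> cmd v y (fun z => f z *: A) (df *: A).
Proof.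
by move=> hf; apply: (mderZr _ _ _ hf) => *;
  first [exact: cderC|exact: cderM].
Qed.

Lemma cmd_sum m l v y (I : Type) (r : seq I) (P : pred I)
    (F : I -> V -> 'M[R[i]]_(m, l)) F' :
  (forall i, cmd v y (F i) (F' i)) ->
  cmd v y (fun z => \sum_(i <- r | P i) F i z) (\sum_(i <- r | P i) F' i).
Proof.
by move=> hF; apply: (mder_sum _ _ _ _ hF) => *;
  first [exact: cderC|exact: cderD].
Qed.

Lemma rmdE m l k y (F : V -> 'M[R]_(m, l)) F' : rmd k y F F' -> pd F k y = F'.
Proof. by move=> h; apply/matrixP => i j; rewrite mxE; have [] := h i j. Qed.

Lemma cmdE m l v y (F : V -> 'M[R[i]]_(m, l)) F' : cmd v y F F' -> cpd F v y = F'.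
Proof.
move=> h; apply/matrixP => i j; rewrite mxE; have [[_ ->] [_ ->]] := h i j.
by case: (F' i j).
Qed.

Lemma rmd_near m l k y (F G : V -> 'M[R]_(m, l)) F' U : open U -> U y ->
  (forall z, U z -> F z = G z) -> rmd k y F F' -> rmd k y G F'.
Proof.
move=> oU Uy e h i j; apply: near_eq_is_derive (h i j).
have nU : \forall x \near y, U x by exact: open_nbhs_nbhs.
by apply: filterS nU => z Uz; rewrite e.
Qed.

Lemma cmd_near m l v y (F G : V -> 'M[R[i]]_(m, l)) F' U : open U -> U y ->
  (forall z, U z -> F z = G z) -> cmd v y F F' -> cmd v y G F'.
Proof.
move=> oU Uy e h i j.
have nU : \forall x \near y, U x by exact: open_nbhs_nbhs.
split; [apply: near_eq_is_derive (h i j).1|apply: near_eq_is_derive (h i j).2];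
  by apply: filterS nU => z Uz; rewrite e.
Qed.

Lemma smooth_derivable U f y v : smooth U f -> U y -> derivable f y v.
Proof. by move=> /(_ 1)[_ /(_ v)[h _]]; exact: h. Qed.

Lemma smooth_D U f v : smooth U f -> smooth U (fun x => 'D_v f x).
Proof. by move=> h k; have [_ /(_ v)[]] := h k.+1. Qed.

Lemma smooth_continuous U f y : smooth U f -> U y -> {for y, continuous f}.
Proof. by move=> /(_ 0)[h _]; exact: h. Qed.

Lemma smooth_is_derive U f y v : smooth U f -> U y -> is_derive y v f ('D_v f y).
Proof. by move=> sf Uy; apply: derivableP; exact: smooth_derivable sf Uy. Qed.

Lemma smooth_comm U f y u v : open U -> smooth U f -> U y ->
  'D_u (fun z => 'D_v f z) y = 'D_v (fun z => 'D_u f z) y.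
Proof.
move=> oU sf Uy; apply: (@derive_comm _ _ f U) => //.
- by move=> w x; exact: smooth_derivable.
- by move=> w w' x; apply: smooth_derivable; exact: smooth_D.
- by move=> w w'; apply: (@smooth_continuous U) => //; do 2 apply: smooth_D.
Qed.

Lemma smooth_subset U U' f : open U' -> U' `<=` U -> smooth U f -> smooth U' f.
Proof.
move=> oU' s sf k; move: f {sf}(sf k); elim: k => [|k ih] f [h1 h2].
  by split=> // x /s; exact: h1.
split; first by move=> x /s; exact: h1.
move=> v; have [d1 d2] := h2 v; split; first by move=> x /s; exact: d1.
exact: ih.
Qed.

Lemma pdE m l (F : V -> 'M[R]_(m, l)) k i j :
  (fun z => pd F k z i j) = (fun z => 'D_(delta_mx 0 k) (fun w => F w i j) z).
Proof. by apply/funext => z; rewrite mxE. Qed.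

Lemma cpd_Re m l (F : V -> 'M[R[i]]_(m, l)) v i j :
  (fun z => complex.Re (cpd F v z i j)) =
  (fun z => 'D_v (fun w => complex.Re (F w i j)) z).
Proof. by apply/funext => z; rewrite mxE. Qed.

Lemma cpd_Im m l (F : V -> 'M[R[i]]_(m, l)) v i j :
  (fun z => complex.Im (cpd F v z i j)) =
  (fun z => 'D_v (fun w => complex.Im (F w i j)) z).
Proof. by apply/funext => z; rewrite mxE. Qed.

Section SmoothMx.
Variables (U : set V) (oU : open U).

Definition smoothmx m l (F : V -> 'M[R]_(m, l)) : Prop :=
  forall i j, smooth U (fun z => F z i j).

Definition csmoothmx m l (F : V -> 'M[R[i]]_(m, l)) : Prop :=
  forall i j, csmooth U (fun z => F z i j).

Lemma rmd_pd m l (F : V -> 'M[R]_(m, l)) k y : smoothmx F -> U y ->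
  rmd k y F (pd F k y).
Proof. by move=> sF Uy i j; rewrite mxE; exact: smooth_is_derive (sF i j) Uy. Qed.

Lemma smooth_pd m l (F : V -> 'M[R]_(m, l)) k : smoothmx F -> smoothmx (pd F k).
Proof.
by move=> sF i j; rewrite pdE; exact: smooth_D.
Qed.

Lemma pd_comm m l (F : V -> 'M[R]_(m, l)) k k' y : smoothmx F -> U y ->
  pd (pd F k) k' y = pd (pd F k') k y.
Proof.
move=> sF Uy; apply/matrixP => i j.
rewrite [LHS]mxE [RHS]mxE /partial !pdE; exact: smooth_comm oU (sF i j) Uy.
Qed.

Lemma cmd_cpd m l (F : V -> 'M[R[i]]_(m, l)) v y : csmoothmx F -> U y ->
  cmd v y F (cpd F v y).
Proof.
move=> sF Uy i j; rewrite mxE; have [s1 s2] := sF i j.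
by split; exact: smooth_is_derive.
Qed.

Lemma cpd_comm m l (F : V -> 'M[R[i]]_(m, l)) u v y : csmoothmx F -> U y ->
  cpd (cpd F u) v y = cpd (cpd F v) u y.
Proof.
move=> sF Uy; apply/matrixP => i j; have [s1 s2] := sF i j.
rewrite [LHS]mxE [RHS]mxE (cpd_Re F) (cpd_Im F) (cpd_Re F v) (cpd_Im F v).
exact: (f_equal2 (@Complex R) (smooth_comm v u oU s1 Uy) (smooth_comm v u oU s2 Uy)).
Qed.
End SmoothMx.
End RealComplexDerivatives.

(** * Matrix algebra of connections and curvatures *)

Lemma sum_scale_row (K : comPzRingType) n m l (A : 'M[K]_(m, n)) (B : 'M[K]_(n, l))
    (X : 'I_l -> 'M[K]_n) i :
  \sum_k A i k *: (\sum_j B k j *: X j) = \sum_j (A *m B) i j *: X j.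
Proof.
under eq_bigr do rewrite scaler_sumr.
rewrite exchange_big; apply: eq_bigr => j _; rewrite mxE scaler_suml.
by apply: eq_bigr => k _; rewrite scalerA.
Qed.

Section StructureEquation.
Variables (K : comPzRingType) (n : nat).
Implicit Types (A B C E F G H P Q W Z : 'M[K]_n).

(** Each hypothesis differentiates w E = dE + E C after substituting dE = w E - E C, and [F] is the
    mixed second derivative of [E] common to both. Subtracting them shows that [E] intertwines the
    two curvatures. *)
Lemma structure_equation (E F W1 W2 w1 w2 C1 C2 D1 D2 : 'M[K]_n) :
  W1 *m E + w1 *m (w2 *m E - E *m C2) =
    F + ((w2 *m E - E *m C2) *m C1 + E *m D1) ->
  W2 *m E + w2 *m (w1 *m E - E *m C1) =
    F + ((w1 *m E - E *m C1) *m C2 + E *m D2) ->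
  (W1 - W2 + (w1 *m w2 - w2 *m w1)) *m E =
    E *m (D1 - D2 + (C1 *m C2 - C2 *m C1)).
Proof.
rewrite !mulmxBr !mulmxBl !mulmxA => h1 h2.
have -> : (W1 - W2 + (w1 *m w2 - w2 *m w1)) *m E =
   (W1 *m E + (w1 *m w2 *m E - w1 *m E *m C2))
   - (W2 *m E + (w2 *m w1 *m E - w2 *m E *m C1))
   + w1 *m E *m C2 - w2 *m E *m C1.
  rewrite !(mulmxDl, mulNmx); mxlin.
rewrite h1 h2 !(mulmxDr, mulmxN) !mulmxA; mxlin.
Qed.

Lemma anti_structure (W1 W2 w1 w2 : 'M[K]_n) :
  W1^T = - W1 -> W2^T = - W2 -> w1^T = - w1 -> w2^T = - w2 ->
  (W1 - W2 + (w1 *m w2 - w2 *m w1))^T = - (W1 - W2 + (w1 *m w2 - w2 *m w1)).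
Proof.
move=> h1 h2 h3 h4; rewrite linearD !linearB /= !trmx_mul h1 h2 h3 h4.
rewrite !mulNmx !mulmxN; mxlin.
Qed.

End StructureEquation.

Lemma scale4_sub (K : numFieldType) m k (A B C : 'M[K]_(m, k)) :
  2 *: (2 *: A) = 2 *: (2 *: B) + 4 *: (2 *: C) -> A - B = 2 *: C.
Proof.
move=> h; apply: double_inj; apply: double_inj => /=.
transitivity (2 *: (2 *: A) - 2 *: (2 *: B)); first by mxlin.
rewrite h; mxlin.
Qed.

(** The second hypothesis equates the two mixed derivatives of a parallel spinor [x]: [A] and [B]
    are the Clifford images of two connection matrices, [P] and [Q] those of their derivatives. *)
Lemma parallel_curv_algebra (K : numFieldType) m
    (A B P Q Z : 'M[K]_m) (x : 'cV[K]_m) :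
  A *m B - B *m A = 2 *: Z ->
  - 2^-1 *: (Q *m x) + 4^-1 *: (B *m (A *m x)) =
  - 2^-1 *: (P *m x) + 4^-1 *: (A *m (B *m x)) ->
  P *m x - Q *m x - Z *m x = 0.
Proof.
move=> hZ h; apply: double_inj; rewrite /= scaler0 scalerBr.
have -> : 2 *: (Z *m x) = A *m (B *m x) - B *m (A *m x).
  by rewrite scalemxAl -hZ mulmxBl !mulmxA.
have := congr1 (fun X => 4 *: X) h.
move=> h4; have -> : 2 *: (P *m x - Q *m x) =
  4 *: (- 2^-1 *: (Q *m x)) - 4 *: (- 2^-1 *: (P *m x)).
  by apply/matrixP => i j; rewrite !(mx_add, mx_opp, mx_scale); field.
move: h4; rewrite !scalerDr => /(canRL (addrK _)) ->.
by apply/matrixP => i j; rewrite !(mx_add, mx_opp, mx_scale, mx_zero); field.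
Qed.

Section CliffordMatrixForms.
Variables (R : realType) (n : nat) (c : clifford_rep R n).
Local Notation rc := (real_complex R).
Local Notation cl A := (clif2 c (fun p q => (A : 'M[R]_n) p q)).

Lemma clif2D (A B : 'M[R]_n) : cl (A + B) = cl A + cl B.
Proof.
rewrite /clif2 -big_split; apply: eq_bigr => p _ /=.
rewrite -big_split; apply: eq_bigr => q _ /=.
by rewrite mx_add rmorphD scalerDl.
Qed.

Lemma clif2Z a (A : 'M[R]_n) : cl (a *: A) = rc a *: cl A.
Proof.
rewrite /clif2 scaler_sumr; apply: eq_bigr => p _ /=.
rewrite scaler_sumr; apply: eq_bigr => q _ /=.
by rewrite mx_scale rmorphM scalerA.
Qed.

Lemma clif20 : cl 0 = 0.
Proof. by rewrite -(scale0r 0) clif2Z rmorph0 scale0r. Qed.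

Lemma clif2N (A : 'M[R]_n) : cl (- A) = - cl A.
Proof. by rewrite -scaleN1r clif2Z rmorphN1 scaleN1r. Qed.

Lemma clif2_mxsum (I : Type) (r : seq I) (P : pred I) (A : I -> 'M[R]_n) :
  cl (\sum_(i <- r | P i) A i) = \sum_(i <- r | P i) cl (A i).
Proof.
elim/big_rec2: _ => [|i y1 y2 _ <-]; first exact: clif20.
exact: clif2D.
Qed.

Lemma clif2_mx_sum (A : 'M[R]_n) : A^T = - A ->
  \sum_p \sum_q rc (A p q) *: (c p *m c q) = 2 *: cl A.
Proof.
by move=> hA; apply: clif2_sum => p q; have /matrixP/(_ q p) := hA; rewrite !mxE.
Qed.

(** Half of the Clifford image represents so(n), with reversed products because matrices act on
    rows. This is what makes half of the connection matrix act on spinors. *)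
Lemma clif2_comm (A B : 'M[R]_n) : A^T = - A -> B^T = - B ->
  cl A *m cl B - cl B *m cl A = 2 *: cl (B *m A - A *m B).
Proof.
move=> hA hB.
have Aa p q : A p q = - A q p by have /matrixP/(_ q p) := hA; rewrite !mxE.
have Ba p q : B p q = - B q p by have /matrixP/(_ q p) := hB; rewrite !mxE.
have hC : (B *m A - A *m B)^T = - (B *m A - A *m B).
  by rewrite linearB /= !trmx_mul hA hB !mulNmx !mulmxN !opprK opprB.
have rcAa p q : rc (A p q) = - rc (A q p) by rewrite Aa rmorphN.
have := @comm_two_forms R[i] n _ c (@cliff_perm R n c) (fun p q => rc (A p q))
  (fun p q => rc (B p q)) rcAa.
rewrite /= !clif2_mx_sum //.
have -> : \sum_p \sum_q rc (B p q) *: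
    ((\sum_r rc (A p r) *: c r) *m c q + c p *m (\sum_r rc (A q r) *: c r))
   = 2 *: cl (B *m A - A *m B).
  rewrite -clif2_mx_sum //.
  transitivity (\sum_p \sum_q \sum_r rc (B p q * A p r) *: (c r *m c q)
     + \sum_p \sum_q \sum_r rc (B p q * A q r) *: (c p *m c r)).
    do 2 (rewrite -big_split; apply: eq_bigr => ? _ /=).
    rewrite scalerDr mulmx_suml mulmx_sumr !scaler_sumr; congr (_ + _);
    apply: eq_bigr => r _.
      by rewrite -scalemxAl scalerA rmorphM.
    by rewrite -scalemxAr scalerA rmorphM.
  transitivity (\sum_p \sum_q (rc (- (A *m B) p q) *: (c p *m c q))
     + \sum_p \sum_q (rc ((B *m A) p q) *: (c p *m c q))).
    congr (_ + _); last first.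
      apply: eq_bigr => p _; rewrite exchange_big; apply: eq_bigr => r _ /=.
      by rewrite -scaler_suml mxE rmorph_sum.
    rewrite exchange_big3; apply: eq_bigr => r _.
    rewrite exchange_big; apply: eq_bigr => q _ /=.
    rewrite -scaler_suml mxE -sumrN rmorph_sum; congr (_ *: _).
    by apply: eq_bigr => p _; congr (rc _); rewrite (Aa r p); ring.
  rewrite -big_split; apply: eq_bigr => p _ /=.
  rewrite -big_split; apply: eq_bigr => q _ /=.
  by rewrite mx_add mx_opp addrC rmorphD scalerDl.
rewrite -!scalemxAl -!scalemxAr; exact: scale4_sub.
Qed.

Lemma cmd_clif2 k y (F : 'rV[R]_n -> 'M[R]_n) F' : rmd k y F F' ->
  cmd (delta_mx 0 k) y (fun z => cl (F z)) (cl F').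
Proof.
move=> hF; rewrite /clif2; do 2 apply: cmd_sum => ?.
by apply: cmdZr; apply: cder_real; exact: hF.
Qed.

End CliffordMatrixForms.

(** * Curvature of a metric connection with parallel skew torsion *)

Section LocalFrame.
Variables (R : realType) (n : nat) (U : set 'rV[R]_n).
Hypothesis oU : open U.
Variables (E G : 'rV[R]_n -> 'M[R]_n) (Gam Tm : 'I_n -> 'rV[R]_n -> 'M[R]_n).
Hypothesis sE : smoothmx U E.
Hypothesis sG : smoothmx U G.
Hypothesis sGam : forall k, smoothmx U (Gam k).
Hypothesis sTm : forall k, smoothmx U (Tm k).
Hypothesis frameK : forall z, U z -> E z *m G z *m (E z)^T = 1%:M.
Hypothesis Gam_sym : forall z, U z -> forall k i l, Gam k z i l = Gam i z k l.
Hypothesis compat : forall z, U z -> forall k,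
  pd G k z = Gam k z *m G z + G z *m (Gam k z)^T.
Hypothesis Tm12 : forall z, U z -> forall k i l, Tm k z i l = - Tm i z k l.
Hypothesis Tm23 : forall z, U z -> forall k i l, Tm k z i l = - Tm k z l i.

(** Orthonormality of the rows of [E] makes this the inverse of [G]. *)
Definition ginv z := (E z)^T *m E z.
Definition GamC k z := Gam k z + 2^-1 *: (Tm k z *m ginv z).

Hypothesis parallel : forall z, U z -> forall l k,
  pd (Tm k) l z = \sum_m GamC l z k m *: Tm m z
    + (GamC l z *m Tm k z + Tm k z *m (GamC l z)^T).

(* The entry [p q] is g(nabla^c_{d_k} e_p, e_q), where the rows e_p of [E] form
   an orthonormal frame. *)
Definition spin_conn k z :=
  (pd E k z + E z *m Gam k z) *m G z *m (E z)^T
  + 2^-1 *: (E z *m Tm k z *m (E z)^T).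

Lemma frame_ginv z : U z -> G z *m (E z)^T *m E z = 1%:M.
Proof. by move=> Uz; apply: mulmx1C; rewrite mulmxA frameK. Qed.

Lemma frame_ginvl z : U z -> ginv z *m G z = 1%:M.
Proof. by move=> Uz; apply: mulmx1C; rewrite mulmxA frame_ginv. Qed.

Lemma G_sym z : U z -> (G z)^T = G z.
Proof.
move=> Uz; have h := frame_ginvl Uz.
have hT : (G z)^T *m ginv z = 1%:M.
  by rewrite -[RHS]trmx1 -h trmx_mul /ginv trmx_mul trmxK.
by rewrite -[LHS]mulmx1 -h mulmxA hT mul1mx.
Qed.

Lemma Tm_tr z k : U z -> (Tm k z)^T = - Tm k z.
Proof. by move=> Uz; apply/matrixP => i j; rewrite !mxE Tm23. Qed.

Lemma spin_connE k z : U z ->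
  spin_conn k z *m E z = pd E k z + E z *m GamC k z.
Proof.
move=> Uz; rewrite /spin_conn /GamC mulmxDl -!mulmxA.
rewrite [G z *m _]mulmxA frame_ginv // mulmx1 mulmxDr -addrA.
by rewrite -scalemxAl -scalemxAr -!mulmxA.
Qed.

Lemma pd_frame k z : U z -> pd E k z = spin_conn k z *m E z - E z *m GamC k z.
Proof. by move=> Uz; rewrite spin_connE // addrK. Qed.

(** The Riemannian part is skew by differentiating [E z *m G z *m (E z)^T] = 1 with a compatible
    connection, the torsion part because T alternates. *)
Lemma spin_conn_anti k z : U z -> (spin_conn k z)^T = - spin_conn k z.
Proof.
move=> Uz.
have rE := rmd_pd k sE Uz; have rG := rmd_pd k sG Uz.
have h1 := rmdM rE rG.
have h2 := rmdM h1 (rmdT rE).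
have h0 := rmdC k z (1%:M : 'M[R]_n).
have := rmdE (rmd_near oU Uz frameK h2); rewrite (rmdE h0) compat // => h.
rewrite /spin_conn linearD /= linearZ /= !trmx_mul !trmxK Tm_tr //.
rewrite mulNmx mulmxN scalerN G_sym // linearD /= trmx_mul.
rewrite opprD mulmxA; congr (_ + _); last by rewrite mulmxA.
apply/eqP; rewrite -subr_eq0 opprK; apply/eqP; rewrite [RHS]h.
rewrite !(mulmxDl, mulmxDr) !mulmxA; mxlin.
Qed.


(* The entry [i j] is the j-th component of R(d_l, d_k) d_i; since components are
   rows, products of connection matrices appear in reversed order. *)
Definition curv l k z := pd (Gam k) l z - pd (Gam l) k z
  + (Gam k z *m Gam l z - Gam l z *m Gam k z).

(** R^c for parallel torsion, already free of derivatives of T: the added terms are half of T(T(X,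
    Y), .) and a quarter of the commutator of T(X, .) and T(Y, .) in row order. *)
Definition curvC l k z := curv l k z
  + 2^-1 *: (\sum_m (Tm l z *m ginv z) k m *: (Tm m z *m ginv z))
  + 4^-1 *: (Tm l z *m ginv z *m (Tm k z *m ginv z)
             - Tm k z *m ginv z *m (Tm l z *m ginv z)).

Definition spin_curv l k z := pd (spin_conn k) l z - pd (spin_conn l) k z
  + (spin_conn k z *m spin_conn l z - spin_conn l z *m spin_conn k z).

Definition dginv l z := - ((GamC l z)^T *m ginv z + ginv z *m GamC l z).

(** The skew matrices [spin_conn] cancel; what remains says that the inverse metric is parallel for
    nabla^c. *)
Lemma rmd_ginv l z : U z -> rmd l z ginv (dginv l z).
Proof.
move=> Uz; have rE := rmd_pd l sE Uz; have := rmdM (rmdT rE) rE.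
rewrite pd_frame // linearB /= !trmx_mul spin_conn_anti //.
suff -> : ((E z)^T *m - spin_conn l z - (GamC l z)^T *m (E z)^T) *m E z +
  (E z)^T *m (spin_conn l z *m E z - E z *m GamC l z) = dginv l z by [].
rewrite /dginv /ginv mulmxBl mulmxBr mulmxN mulNmx !mulmxA; mxlin.
Qed.

(** T and the inverse metric are both parallel for nabla^c, so the derivative of the torsion part of
    [GamC] is an expression in [GamC] and T themselves. *)
Lemma rmd_GamC l k z : U z -> rmd l z (GamC k) (pd (Gam k) l z + 2^-1 *:
  (\sum_m GamC l z k m *: (Tm m z *m ginv z)
   + (GamC l z *m (Tm k z *m ginv z) - Tm k z *m ginv z *m GamC l z))).
Proof.
move=> Uz; have rH := rmd_ginv l Uz.
have rG := rmd_pd l (sGam k) Uz; have rT := rmd_pd l (sTm k) Uz.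
have := rmdD rG (rmdZ 2^-1 (rmdM rT rH)); rewrite parallel // /dginv.
rewrite 2!mulmxDl mulmx_suml mulmxN mulmxDr !mulmxA.
under eq_bigr do rewrite -scalemxAl.
set X := (X in rmd _ _ _ X -> _); set Y := (Y in _ -> rmd _ _ _ Y).
suff -> : X = Y by [].
by rewrite /X /Y; congr (_ + _ *: _); mxlin.
Qed.

Lemma smooth_spin_conn l k z : U z -> rmd l z (spin_conn k) (pd (spin_conn k) l z).
Proof.
move=> Uz.
have rE := rmd_pd l sE Uz; have rG := rmd_pd l sG Uz.
have rGam := rmd_pd l (sGam k) Uz; have rT := rmd_pd l (sTm k) Uz.
have rpE := rmd_pd l (smooth_pd k sE) Uz.
have := rmdD (rmdM (rmdM (rmdD rpE (rmdM rE rGam)) rG) (rmdT rE))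
  (rmdZ 2^-1 (rmdM (rmdM rE rT) (rmdT rE))).
by move=> h; rewrite (rmdE h).
Qed.

Lemma frame_curvature l k z : U z -> spin_curv l k z *m E z = E z *m curvC l k z.
Proof.
move=> Uz.
have dframe l' k' : pd (spin_conn k') l' z *m E z
   + spin_conn k' z *m (spin_conn l' z *m E z - E z *m GamC l' z)
  = pd (pd E k') l' z +
    ((spin_conn l' z *m E z - E z *m GamC l' z) *m GamC k' z
     + E z *m pd (GamC k') l' z).
  rewrite -pd_frame //.
  have rE := rmd_pd l' sE Uz; have rw := smooth_spin_conn l' k' Uz.
  have rpE := rmd_pd l' (smooth_pd k' sE) Uz.
  have rC := rmd_GamC l' k' Uz.
  rewrite (rmdE rC).
  have h := rmdD rpE (rmdM rE rC).
  rewrite -(rmdE (rmdM rw rE)) -(rmdE h).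
  rewrite (rmdE h); apply: rmdE; apply: (rmd_near oU Uz _ h) => x Ux.
  exact: esym (spin_connE k' Ux).
have := structure_equation (dframe l k); rewrite (pd_comm oU _ _ sE Uz).
move=> /(_ _ _ (dframe k l)) ->; congr (_ *m _).
rewrite (rmdE (rmd_GamC l k Uz)) (rmdE (rmd_GamC k l Uz)) /curvC /curv.
(* The torsion of nabla^c is T: the symmetric Christoffel parts cancel in the difference and the two
   halves of T add up. *)
have -> : \sum_m (Tm l z *m ginv z) k m *: (Tm m z *m ginv z) =
  \sum_m GamC l z k m *: (Tm m z *m ginv z)
  - \sum_m GamC k z l m *: (Tm m z *m ginv z).
  rewrite -sumrB; apply: eq_bigr => m _; rewrite -scalerBl; congr (_ *: _).
  have -> : (Tm l z *m ginv z) k m = - (Tm k z *m ginv z) l m.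
    rewrite !mxE -sumrN; apply: eq_bigr => p _.
    by rewrite Tm12 // mulNr.
  rewrite /GamC !mx_add !mx_scale (Gam_sym Uz l).
  have -> : (Tm l z *m ginv z) k m = - (Tm k z *m ginv z) l m.
    rewrite !mxE -sumrN; apply: eq_bigr => p _.
    by rewrite Tm12 // mulNr.
  by move: (_ *m _); move=> X; lra.
set Sl := \sum_m GamC l z k m *: _; set Sk := \sum_m GamC k z l m *: _.
rewrite /GamC; move: (Tm l z *m ginv z) (Tm k z *m ginv z) Sl Sk (Gam l z) (Gam k z).
move=> A B Sl Sk Cl Ck.
rewrite !(mulmxDl, mulmxDr) -!scalemxAl -!scalemxAr.
by apply/matrixP => i j; rewrite !(mx_add, mx_opp, mx_scale); field.
Qed.


Definition frame_form z a : 'M[R]_n :=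
  \sum_l E z a l *: (E z *m Tm l z *m (E z)^T).

Definition frame_sum2 z (X : 'I_n -> 'I_n -> 'M[R]_n) a b : 'M[R]_n :=
  \sum_l \sum_k E z a l *: (E z b k *: X l k).

Definition frame_curv z :=
  frame_sum2 z (fun l k => E z *m curv l k z *m G z *m (E z)^T).

Lemma frame_formE z a p q : frame_form z a p q =
  \sum_l \sum_i \sum_j E z a l * (E z p i * (E z q j * Tm l z i j)).
Proof.
rewrite /frame_form summxE; apply: eq_bigr => l _.
rewrite !mxE mulr_sumr exchange_big; apply: eq_bigr => j _ /=.
rewrite !mxE mulr_suml mulr_sumr; apply: eq_bigr => i _; ring.
Qed.

Lemma frame_form12 z a p q : U z -> frame_form z a p q = - frame_form z p a q.
Proof.
move=> Uz; rewrite !frame_formE exchange_big -sumrN; apply: eq_bigr => i _.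
rewrite -sumrN; apply: eq_bigr => l _; rewrite -sumrN; apply: eq_bigr => j _.
by rewrite Tm12 //; ring.
Qed.

Lemma frame_form_tr z a : U z -> (frame_form z a)^T = - frame_form z a.
Proof.
move=> Uz; rewrite /frame_form linear_sum -sumrN; apply: eq_bigr => l _.
rewrite linearZ /= !trmx_mul trmxK Tm_tr // mulNmx mulmxN scalerN.
by rewrite mulmxA.
Qed.

Lemma frame_form23 z a p q : U z -> frame_form z a p q = - frame_form z a q p.
Proof.
by move=> Uz; have /matrixP/(_ q p) := frame_form_tr a Uz; rewrite !mxE.
Qed.

Lemma spin_curvE l k z : U z -> spin_curv l k z =
  E z *m curv l k z *m G z *m (E z)^T
  + 2^-1 *: (\sum_m (Tm l z *m ginv z) k m *: (E z *m Tm m z *m (E z)^T))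
  + 4^-1 *: (E z *m Tm l z *m (E z)^T *m (E z *m Tm k z *m (E z)^T)
    - E z *m Tm k z *m (E z)^T *m (E z *m Tm l z *m (E z)^T)).
Proof.
move=> Uz.
have -> : spin_curv l k z = E z *m curvC l k z *m G z *m (E z)^T.
  rewrite -frame_curvature // -2!mulmxA [E z *m (G z *m _)]mulmxA frameK //.
  by rewrite mulmx1.
(* [H] keeps the inverse metric opaque: it is cancelled against [G] first, and expanded as E^T E
   only between two torsion factors. *)
have [H HE] : exists H, H = ginv z by exists (ginv z).
have e X : X *m H *m G z = X by rewrite -mulmxA HE frame_ginvl ?mulmx1.
rewrite /curvC -HE !(mulmxDl, mulmxDr); congr (_ + _ + _).
  rewrite -!scalemxAr -!scalemxAl mulmx_sumr !mulmx_suml; congr (_ *: _).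
  apply: eq_bigr => m _.
  by rewrite -scalemxAr -!scalemxAl mulmxA e.
rewrite -!scalemxAr -!scalemxAl; congr (_ *: _).
rewrite mulmxBr !mulmxBl !mulmxA !e.
have eH Y : Y *m H = Y *m (E z)^T *m E z by rewrite HE /ginv mulmxA.
by rewrite !eH.
Qed.

(** The decomposition required by [cliff_curvature_torsion]. Matrix products of torsion forms become
    pairings in the first slot after the alternation rules are applied to each factor. *)
Lemma frame_spin_curv z a b p q : U z ->
  frame_sum2 z (fun l k => spin_curv l k z) a b p q =
  frame_curv z a b p q
  + 2^-1 * \sum_m frame_form z m a b * frame_form z m p q
  + 4^-1 * (\sum_m frame_form z m a q * frame_form z m b p
            - \sum_m frame_form z m a p * frame_form z m b q).
Proof.
move=> Uz; pose X l := E z *m Tm l z *m (E z)^T.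
have -> : frame_sum2 z (fun l k => spin_curv l k z) a b =
  frame_curv z a b + 2^-1 *: (\sum_m frame_form z a b m *: frame_form z m)
  + 4^-1 *: (frame_form z a *m frame_form z b - frame_form z b *m frame_form z a).
  transitivity (frame_curv z a b
    + 2^-1 *: \sum_l E z a l *: \sum_k E z b k *:
       (\sum_m (Tm l z *m ginv z) k m *: X m)
    + 4^-1 *: (\sum_l \sum_k (E z a l *: X l) *m (E z b k *: X k)
               - \sum_l \sum_k (E z b k *: X k) *m (E z a l *: X l))).
    rewrite -sumrB !scaler_sumr -!big_split; apply: eq_bigr => l _ /=.
    rewrite -sumrB !scaler_sumr -!big_split; apply: eq_bigr => k _ /=.
    rewrite spin_curvE // -/(X l) -/(X k) -!scalemxAl -!scalemxAr.
    by rewrite !scalerDr !scalerN !scalerA; mxlin.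
  congr (_ + _ *: _ + _ *: (_ - _)).
  - under eq_bigr => l _.
      rewrite sum_scale_row mulmxA mulmxA -sum_scale_row.
      over.
    under eq_bigr do rewrite scaler_sumr.
    rewrite exchange_big; apply: eq_bigr => s _ /=.
    rewrite /frame_form summxE scaler_suml; apply: eq_bigr => l _.
    by rewrite mx_scale scalerA.
  - rewrite /frame_form mulmx_suml; apply: eq_bigr => l _.
    by rewrite mulmx_sumr.
  rewrite exchange_big /frame_form mulmx_suml; apply: eq_bigr => l _.
  by rewrite mulmx_sumr.
rewrite !(mx_add, mx_scale, mx_opp); congr (_ + _ * _ + _ * _).
  rewrite summxE; apply: eq_bigr => m _; rewrite mx_scale.
  by rewrite (@frame_form12 z m a b) // (@frame_form23 z a m b) // opprK.
rewrite !mxE addrC; congr (_ + _); rewrite -?sumrN; apply: eq_bigr => m _.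
  rewrite (@frame_form23 z b p m) // (@frame_form12 z b m p) //.
  by rewrite (@frame_form12 z a m q) //; ring.
rewrite (@frame_form23 z a p m) // (@frame_form12 z a m p) //.
by rewrite (@frame_form12 z b m q) //; ring.
Qed.


Lemma pd_spin_conn_anti l k z : U z ->
  (pd (spin_conn k) l z)^T = - pd (spin_conn k) l z.
Proof.
move=> Uz; have h := rmdT (smooth_spin_conn l k Uz).
have h' := rmdZ (-1) (smooth_spin_conn l k Uz).
rewrite -(rmdE h) -[RHS]scaleN1r -(rmdE h'); apply: rmdE.
rewrite (rmdE h'); apply: (rmd_near oU Uz _ h') => x Ux.
by rewrite spin_conn_anti // scaleN1r.
Qed.

Lemma spin_curv_anti l k z : U z -> (spin_curv l k z)^T = - spin_curv l k z.
Proof.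
by move=> Uz; apply: anti_structure; rewrite ?pd_spin_conn_anti ?spin_conn_anti.
Qed.

Lemma frame_sum2_anti z X a b : (forall l k, (X l k)^T = - X l k) ->
  (frame_sum2 z X a b)^T = - frame_sum2 z X a b.
Proof.
move=> h; rewrite /frame_sum2 linear_sum -sumrN; apply: eq_bigr => l _ /=.
rewrite linear_sum -sumrN; apply: eq_bigr => k _ /=.
by rewrite !linearZ /= h !scalerN.
Qed.

(** Obtained through nabla^c: [spin_curv] is skew because it is built from skew connection matrices,
    the quadratic torsion terms are visibly skew in p and q, and R^g is the difference. *)
Lemma frame_curv34 z a b p q : U z ->
  frame_curv z a b p q = - frame_curv z a b q p.
Proof.
move=> Uz.
have /matrixP/(_ q p) := frame_sum2_anti z a b (fun l k => spin_curv_anti l k Uz).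
rewrite [LHS]mxE mx_opp !frame_spin_curv //.
have -> : \sum_m frame_form z m a b * frame_form z m q p
  = - \sum_m frame_form z m a b * frame_form z m p q.
  rewrite -sumrN; apply: eq_bigr => m _.
  by rewrite (@frame_form23 z m q p) // mulrN.
by move: (\sum_m _) (\sum_m _) (\sum_m _) => A B C; lra.
Qed.

Lemma frame_curv12 z a b p q : frame_curv z a b p q = - frame_curv z b a p q.
Proof.
suff -> : frame_curv z a b = - frame_curv z b a by rewrite mx_opp.
rewrite /frame_curv /frame_sum2 exchange_big -sumrN.
apply: eq_bigr => l _; rewrite -sumrN; apply: eq_bigr => k _.
have -> : curv k l z = - curv l k z by rewrite /curv; mxlin.
by rewrite mulmxN !mulNmx !scalerN !scalerA mulrC.
Qed.

(** The first Bianchi identity: symmetry of the Christoffel symbols in the lower indices makes the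
    six derivatives and the six products cancel in pairs. Symmetry is known on [U] only, so
    derivatives are compared near z. *)
Lemma curv_cyc z l k i : U z ->
  row i (curv l k z) + row l (curv k i z) + row k (curv i l z) = 0.
Proof.
move=> Uz; apply/rowP => j; rewrite !(mx_add, mx_opp, mxE).
have h a b d : partial d (fun w => Gam a w b j) z = partial d (fun w => Gam b w a j) z.
  apply: near_eq_derive.
  have nU : \forall x \near z, U x by exact: open_nbhs_nbhs.
  by apply: filterS nU => x Ux; rewrite Gam_sym.
have h2 a b d : \sum_m Gam d z a m * Gam b z m j = \sum_m Gam a z d m * Gam b z m j.
  by apply: eq_bigr => m _; rewrite Gam_sym.
rewrite (h k i l) (h l i k) (h k l i) (h2 i l k) (h2 i k l) (h2 l i k).
ring.
Qed.

Lemma frame_curvE z a b p q : frame_curv z a b p q =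
  \sum_l \sum_k \sum_i E z a l * (E z b k * (E z p i *
     (row i (curv l k z) *m (G z *m (E z)^T)) 0 q)).
Proof.
rewrite /frame_curv /frame_sum2 summxE; apply: eq_bigr => l _.
rewrite summxE; apply: eq_bigr => k _; rewrite !mx_scale -!mulr_sumr.
congr (_ * (_ * _)); rewrite -!mulmxA mxE; apply: eq_bigr => i _.
by rewrite -row_mul [in RHS]mxE.
Qed.

Lemma frame_curv_cyc z a b p q : U z ->
  frame_curv z a b p q + frame_curv z b p a q + frame_curv z p a b q = 0.
Proof.
move=> Uz; rewrite !frame_curvE.
set X := fun l k i => (row i (curv l k z) *m (G z *m (E z)^T)) 0 q.
have -> : \sum_l \sum_k \sum_i E z b l * (E z p k * (E z a i * X l k i)) =
   \sum_l \sum_k \sum_i E z a l * (E z b k * (E z p i * X k i l)).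
  rewrite exchange_big3; apply: eq_bigr => l _; apply: eq_bigr => k _.
  by apply: eq_bigr => i _; ring.
have -> : \sum_l \sum_k \sum_i E z p l * (E z a k * (E z b i * X l k i)) =
   \sum_l \sum_k \sum_i E z a l * (E z b k * (E z p i * X i l k)).
  rewrite [RHS]exchange_big3; apply: eq_bigr => i _; apply: eq_bigr => l _.
  by apply: eq_bigr => k _; ring.
rewrite -!big_split big1 // => l _; rewrite -!big_split big1 // => k _.
rewrite -!big_split big1 // => i _ /=; rewrite -!mulrDr.
by rewrite /X -!mx_add -!mulmxDl curv_cyc // mul0mx mxE !mulr0.
Qed.

(** The trace over the frame is the trace over coordinates: summing e_b twice gives the inverse
    metric, and [G] E^T is the inverse of [E]. *)
Lemma frame_scal z : U z -> \sum_a \sum_b frame_curv z a b b a =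
  \sum_j \sum_k ginv z j k * \sum_i curv i j z k i.
Proof.
move=> Uz.
have e1 k i : ginv z k i = \sum_b E z b k * E z b i.
  by rewrite mxE; apply: eq_bigr => b _; rewrite mxE.
have e2 j l : \sum_a (G z *m (E z)^T) j a * E z a l = (j == l)%:R.
  by have /matrixP/(_ j l) := frame_ginv Uz; rewrite !mxE.
transitivity (\sum_l \sum_k \sum_i
    (\sum_b E z b k * E z b i) * \sum_j curv l k z i j * (j == l)%:R).
  transitivity (\sum_l \sum_k \sum_i \sum_a \sum_b (E z b k * E z b i) *
     (\sum_j curv l k z i j * ((G z *m (E z)^T) j a * E z a l))).
    under eq_bigr do under eq_bigr do rewrite frame_curvE.
    rewrite pair_big exchange_big; apply: eq_bigr => l _ /=.
    rewrite exchange_big; apply: eq_bigr => k _ /=.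
    rewrite exchange_big; apply: eq_bigr => i _ /=.
    rewrite [RHS]pair_big; apply: eq_bigr => -[a b] _ /=.
    rewrite mxE !mulr_sumr; apply: eq_bigr => j _.
    by rewrite [row _ _ _ _]mxE; ring.
  apply: eq_bigr => l _; apply: eq_bigr => k _; apply: eq_bigr => i _.
  rewrite exchange_big mulr_suml; apply: eq_bigr => b _ /=.
  rewrite -mulr_sumr exchange_big; congr (_ * _); apply: eq_bigr => j _ /=.
  by rewrite -mulr_sumr e2.
rewrite -exchange_big3; apply: eq_bigr => k _; apply: eq_bigr => i _.
rewrite mulr_sumr; apply: eq_bigr => l _; rewrite -e1; congr (_ * _).
rewrite (bigD1 l) //= eqxx mulr1 big1 ?addr0 // => j /negbTE ->.
by rewrite mulr0.
Qed.

Local Notation rc := (real_complex R).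
Local Notation w := spin_conn.
Local Notation Omega := spin_curv.
Variable c : clifford_rep R n.
Local Notation cl A := (clif2 c (fun p q => (A : 'M[R]_n) p q)).
Variable phi : 'rV[R]_n -> 'cV[R[i]]_(2 ^ n./2).
Hypothesis sphi : csmoothmx U phi.
Hypothesis dphi : forall z, U z -> forall k,
  cpd phi (delta_mx 0 k) z = - 2^-1 *: (cl (w k z) *m phi z).

Lemma cpd2_parallel l k z : U z ->
  cpd (cpd phi (delta_mx 0 k)) (delta_mx 0 l) z =
  - 2^-1 *: (cl (pd (w k) l z) *m phi z)
  + 4^-1 *: (cl (w k z) *m (cl (w l z) *m phi z)).
Proof.
move=> Uz.
have rw := cmd_clif2 c (smooth_spin_conn l k Uz).
have rphi := cmd_cpd (delta_mx 0 l) sphi Uz.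
have h := cmdZ (- 2^-1) (cmdM rw rphi).
have := cmd_near oU Uz (fun x Ux => esym (dphi Ux k)) h.
move=> /cmdE ->; rewrite dphi // -scalemxAr scalerDr; congr (_ + _).
rewrite scalerA; congr (_ *: _); rewrite mulrNN -invfM.
by rewrite -natrM.
Qed.

(** Second derivatives of [phi] commute, and [clif2_comm] converts the commutator of Clifford images
    into the image of the quadratic part of the curvature. *)
Lemma spin_curv_parallel l k z : U z -> cl (Omega l k z) *m phi z = 0.
Proof.
move=> Uz.
have hx := etrans (esym (cpd2_parallel k l Uz))
  (etrans (cpd_comm oU (delta_mx 0 l) (delta_mx 0 k) sphi Uz)
    (cpd2_parallel l k Uz)).
have hc := clif2_comm c (spin_conn_anti k Uz)
   (spin_conn_anti l Uz).
have -> : Omega l k z = pd (w k) l z - pd (w l) k z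
    - (w l z *m w k z - w k z *m w l z) by rewrite /spin_curv opprB.
rewrite 2!clif2D 2!clif2N 2!mulmxDl 2!mulNmx.
exact: (parallel_curv_algebra hc hx).
Qed.


(* This is 6 ||T||^2: the sum runs over all ordered triples of indices. *)
Definition frame_normsq z : R :=
  \sum_a \sum_b \sum_r frame_form z a b r ^+ 2.

Definition frame_scalar z : R :=
  \sum_j \sum_k ginv z j k * \sum_i curv i j z k i.

Lemma parallel_scal_cliff z : U z ->
  (4 *: (\sum_a cl (frame_form z a) *m cl (frame_form z a))
   + rc (2 * frame_scalar z + 3 / 2 * frame_normsq z) *: 1%:M) *m phi z = 0.
Proof.
move=> Uz.
pose O a b := frame_sum2 z (fun l k => Omega l k z) a b.
have OA a b : (O a b)^T = - O a b.
  apply: frame_sum2_anti => l k; exact: spin_curv_anti.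
have Ophi a b : cl (O a b) *m phi z = 0.
  rewrite /O /frame_sum2 clif2_mxsum mulmx_suml big1 // => l _.
  rewrite clif2_mxsum mulmx_suml big1 // => k _.
  by rewrite !clif2Z -!scalemxAl spin_curv_parallel // !scaler0.
have -> : frame_scalar z = \sum_a \sum_b frame_curv z a b b a.
  by rewrite frame_scal.
rewrite -(@cliff_curvature_torsion R n c (fun a b r => frame_form z a b r) _
  (fun a b p q => frame_curv z a b p q) (fun a b p q => O a b p q)).
- rewrite mulmx_suml big1 // => a _; rewrite mulmx_suml big1 // => b _.
  transitivity (c a *m (c b *m ((2 *: cl (O a b)) *m phi z))); last first.
    by rewrite -scalemxAl Ophi scaler0 !mulmx0.
  rewrite -clif2_mx_sum // !mulmx_suml !mulmx_sumr; apply: eq_bigr => p _.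
  rewrite !mulmx_suml !mulmx_sumr; apply: eq_bigr => q _.
  by rewrite -!scalemxAl -!scalemxAr !mulmxA.
- by move=> p q r; apply: frame_form23.
- by move=> a b p q; apply: frame_curv12.
- move=> a b p q; exact: frame_curv34.
- move=> a b p q; exact: frame_curv_cyc.
- move=> a b p q; exact: frame_spin_curv.
Qed.

End LocalFrame.

(** * Spinors *)

Section EigenSpinor.
Variables (R : realType) (n : nat) (c : clifford_rep R n).
Local Notation rc := (real_complex R).
Variable t : 'I_n -> 'I_n -> 'I_n -> R.
Hypothesis t12 : forall p q r, t p q r = - t q p r.
Hypothesis t23 : forall p q r, t p q r = - t p r q.
Variables (gamma : R) (phi : 'cV[R[i]]_(2 ^ n./2)).
Hypothesis phi0 : phi <> 0.
Hypothesis eigen : clif3 c t *m phi = rc gamma *: phi.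

Let nsq := \sum_a \sum_b \sum_r t a b r ^+ 2.
Let T a := clif2 c (t a).

Lemma scaler_phi (x : R) : rc x *: phi = 0 -> x = 0.
Proof.
by move=> /eqP; rewrite scaler_eq0 => /orP[/eqP/complexI//|/eqP /phi0].
Qed.

(** A single T_a need not preserve the line of [phi], but by [clif3_sq] the sum of their squares
    does, as T^2 acts by gamma^2. *)
Lemma clif2_sq_eigen :
  (\sum_a T a *m T a) *m phi = rc (- (gamma ^+ 2 + nsq / 3)) *: phi.
Proof.
have -> : \sum_a T a *m T a = - (clif3 c t *m clif3 c t) - rc (nsq / 3) *: 1%:M.
  by rewrite (clif3_sq c t12 t23); mxlin.
rewrite mulmxBl mulNmx -mulmxA eigen -scalemxAr eigen -scalemxAl mul1mx.
rewrite rmorphN rmorphD rmorphXn /=; mxlin.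
Qed.

Lemma scal_eigen (s : R) :
  (4 *: (\sum_a T a *m T a) + rc (2 * s + 3 / 2 * nsq) *: 1%:M) *m phi = 0 ->
  2 * s = 4 * gamma ^+ 2 - nsq / 6.
Proof.
rewrite mulmxDl -!scalemxAl clif2_sq_eigen mul1mx => h.
have /scaler_phi : rc (4 * - (gamma ^+ 2 + nsq / 3) + (2 * s + 3 / 2 * nsq)) *: phi = 0.
  by rewrite rmorphD scalerDl (rmorphM rc 4) rmorph_nat -scalerA.
lra.
Qed.

Lemma clif4_eigen (w : 'I_n -> 'I_n -> 'I_n -> 'I_n -> R) :
  (forall p q r s, w p q r s = 2 * (\sum_m t m p q * t m r s
      - \sum_m t m p r * t m q s + \sum_m t m p s * t m q r)) ->
  clif4 c w *m phi = rc (nsq / 6 - gamma ^+ 2) *: phi.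
Proof.
move=> /(clif4_pair c t23) ->.
rewrite mulmxDl clif2_sq_eigen -scalemxAl mul1mx -scalerDl -rmorphD.
by congr (rc _ *: _); rewrite -/nsq; field.
Qed.

Hypothesis n0 : (0 < n)%N.

(** The shift s = 3 gamma / n maximises 6 s gamma - n s^2, whose value is then 9 gamma^2 / n; by
    [killing_number] it is also the only shift for which all the operators can kill [phi]. *)
Lemma twistor_eigen : (forall a, (T a + rc (3 * gamma / n%:R) *: c a) *m phi = 0)
  <-> gamma ^+ 2 + nsq / 3 = 9 * gamma ^+ 2 / n%:R.
Proof.
have nn : n%:R != 0 :> R by rewrite pnatr_eq0 -lt0n.
set s := 3 * gamma / n%:R.
have key : (\sum_a (T a + rc s *: c a) *m (T a + rc s *: c a)) *m phi =
   rc (9 * gamma ^+ 2 / n%:R - (gamma ^+ 2 + nsq / 3)) *: phi.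
  rewrite (sum_twistor_sq c t12 t23) mulmxBl mulmxDl clif2_sq_eigen -!scalemxAl.
  rewrite eigen mul1mx scalerA -rmorphM -scalerDl -scalerBl -rmorphD -rmorphB.
  by congr (rc _ *: _); rewrite /s; field.
split=> [h|h].
  have /scaler_phi : rc (9 * gamma ^+ 2 / n%:R - (gamma ^+ 2 + nsq / 3)) *: phi = 0.
    by rewrite -key mulmx_suml big1 // => a _; rewrite -mulmxA h mulmx0.
  by move=> /eqP; rewrite subr_eq0 => /eqP.
apply: skew_sq_sum_eq0; last by rewrite key h subrr rmorph0 scale0r.
by move=> a; rewrite adjD adjZ adj_clif2 adj_cliff scalerN opprD.
Qed.

(** Multiplying by [c a] and summing uses that the [c a *m T a] sum to 3 T and the squares of the
    [c a] to - n, which leaves 3 gamma = 4 n kappa. *)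
Lemma killing_number (kappa : R) :
  (forall a, (T a + rc (4 * kappa) *: c a) *m phi = 0) ->
  kappa = 3 * gamma / (4 * n%:R).
Proof.
move=> h; have nn : n%:R != 0 :> R by rewrite pnatr_eq0 -lt0n.
have /scaler_phi : rc (3 * gamma - 4 * kappa * n%:R) *: phi = 0.
  transitivity ((\sum_a c a *m (T a + rc (4 * kappa) *: c a)) *m phi); last first.
    by rewrite mulmx_suml big1 // => a _; rewrite -mulmxA h mulmx0.
  under eq_bigr do rewrite mulmxDr -scalemxAr.
  rewrite big_split /= (sum_cliff_clif2 c t12 t23) -scaler_sumr cliff_sq_sum.
  rewrite mulmxDl -!scalemxAl eigen mul1mx rmorphB !rmorphM !rmorph_nat /=; mxlin.
have n4 : 4 * n%:R != 0 :> R by rewrite mulf_neq0 // pnatr_eq0.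
by move=> e; apply: (mulIf n4); rewrite divfK //; lra.
Qed.
End EigenSpinor.

(** * Constancy of the norm under skew-Hermitian transport *)

Section NormDerivative.
Variables (R : realType) (n m : nat).
Local Notation rc := (real_complex R).

Lemma Re_adj (phi d : 'cV[R[i]]_m) : complex.Re ((adj phi *m d) 0 0) =
  \sum_k (complex.Re (phi k 0) * complex.Re (d k 0)
          + complex.Im (phi k 0) * complex.Im (d k 0)).
Proof.
rewrite mxE raddf_sum; apply: eq_bigr => k _; rewrite !mxE /=.
by case: (phi k 0) (d k 0) => [a b] [a' b'] /=; ring.
Qed.

Lemma skew_Re0 (S : 'M[R[i]]_m) (phi : 'cV[R[i]]_m) :
  adj S = - S -> complex.Re ((adj phi *m (S *m phi)) 0 0) = 0.
Proof.
move=> hS; set x := (adj phi *m (S *m phi)) 0 0.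
have : conjc x = - x.
  have : adj (adj phi *m (S *m phi)) = - (adj phi *m (S *m phi)).
    rewrite !adjM hS mulmxN mulNmx; congr (- _); rewrite -mulmxA.
    by congr (_ *m (_ *m _)); apply/matrixP => i j; rewrite !mxE conjcK.
  by move=> /matrixP/(_ 0 0); rewrite [LHS]mxE [LHS]mxE [RHS]mxE.
by move=> /(congr1 (@complex.Re R)); case: (x) => a b /=; lra.
Qed.

(** The derivative is twice the real part of the product of F with S F, and that product is
    imaginary for skew-Hermitian [S]. *)
Lemma normsq_derive (F : 'rV[R]_n -> 'cV[R[i]]_m) v y (S : 'M[R[i]]_m) :
  adj S = - S -> cmd v y F (S *m F y) -> is_derive y v (fun z => normsq (F z)) 0.
Proof.
move=> hS hF; rewrite /normsq.
have h k := is_deriveDf (is_deriveMf (hF k 0).1 (hF k 0).1)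
  (is_deriveMf (hF k 0).2 (hF k 0).2).
have hD := @der_sum 'rV[R]_n R (fun f d => is_derive y v f d)
  (fun a => @is_deriveC R n y v a) (fun f df g dg => @is_deriveDf R n y v f g df dg)
  _ (index_enum 'I_m) predT _ _ h.
apply: is_derive_eq hD _.
transitivity (2 * complex.Re ((adj (F y) *m (S *m F y)) 0 0)).
  rewrite Re_adj mulr_sumr; apply: eq_bigr => k _; ring.
by rewrite skew_Re0 // mulr0.
Qed.
End NormDerivative.

(** As 1/4 = 1/2 * 1/2, the torsion term of nabla^c on spinors enters the connection matrix as half
    of the torsion matrix, in agreement with [spin_conn]. *)
Lemma half_quarter (R : realType) m k (A B : 'M[R[i]]_m) (x : 'M[R[i]]_(m, k)) :
  - (2^-1 *: (A *m x) + 4^-1 *: (B *m x)) =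
  - 2^-1 *: ((A + (2^-1)%:C%C *: B) *m x).
Proof.
rewrite mulmxDl -scalemxAl scalerDr scalerA opprD -!scaleNr; congr (_ + _ *: _).
by rewrite fmorphV rmorph_nat mulNr -invfM -natrM.
Qed.

(** * From tensor components to the matrices of a local frame *)

Section Bridge.
Variables (R : realType) (n : nat) (M : topologicalType).
Variables (X : smooth_manifold R n M) (g : riemannian_metric X).
Variables (T : three_form X) (D : connection X) (c : clifford_rep R n).
Variables (P : spin_structure g c) (phi0 : spinor_field P) (j : strv P).
Local Notation a := (schart j).
Local Notation rc := (real_complex R).

Definition gamma_mx k z : 'M[R]_n := \matrix_(i, l) D a z k i l.
Definition form_mx k z : 'M[R]_n := \matrix_(p, q) T a z k p q.
Local Notation E := (frame j).
Local Notation tfr := (frame_form (frame j) form_mx).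

Lemma simg_open : open (simg j).
Proof.
rewrite openE => y [cy sy]; rewrite /interior.
have n1 : nbhs y (cimg a) by apply: open_nbhs_nbhs; split => //; exact: cimg_open.
have n2 : nbhs y (param a @^-1` sdom j).
  apply: (param_continuous cy); apply: open_nbhs_nbhs; split => //.
  exact: sdom_open.
by apply: filterS (filterI n1 n2).
Qed.

Lemma simg_cimg y : simg j y -> cimg a y.
Proof. by case. Qed.

Lemma frame_smoothmx : smoothmx (simg j) E.
Proof. by move=> p q; exact: frame_smooth. Qed.

Lemma metric_smoothmx : smoothmx (simg j) (g a).
Proof.
move=> p q; exact: (smooth_subset simg_open simg_cimg (@metric_smooth R n M X g a p q)).
Qed.

Lemma gamma_smoothmx k : smoothmx (simg j) (gamma_mx k).
Proof.
move=> p q; rewrite /gamma_mx; under eq_fun do rewrite mxE.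
exact: (smooth_subset simg_open simg_cimg (@christoffel_smooth R n M X D a k p q)).
Qed.

Lemma form_smoothmx k : smoothmx (simg j) (form_mx k).
Proof.
move=> p q; rewrite /form_mx; under eq_fun do rewrite mxE.
exact: (smooth_subset simg_open simg_cimg (@form_smooth R n M X T a k p q)).
Qed.

Lemma form_evalE y p q r :
  form_eval T a y (row p (E y)) (row q (E y)) (row r (E y)) = tfr y p q r.
Proof.
rewrite frame_formE /form_eval; apply: eq_bigr => l _; apply: eq_bigr => i _.
by apply: eq_bigr => k _; rewrite !mxE; ring.
Qed.

Lemma form_eval_delta y k p q :
  form_eval T a y (delta_mx 0 k) (row p (E y)) (row q (E y)) =
  (E y *m form_mx k y *m (E y)^T) p q.
Proof.
rewrite /form_eval (bigD1 k) //= [X in _ + X]big1 ?addr0; last first.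
  move=> l lk; rewrite big1 // => i _; rewrite big1 // => r _.
  by rewrite !mxE (negbTE lk) andbF mulr0 !mul0r.
rewrite [RHS]mxE exchange_big; apply: eq_bigr => r _ /=.
rewrite [(E y *m _) p r]mxE mulr_suml; apply: eq_bigr => i _.
by rewrite !mxE !eqxx /=; ring.
Qed.

Lemma inner_row y u q : inner g a y u (row q (E y)) = (u *m g a y *m (E y)^T) 0 q.
Proof.
rewrite /inner mxE [RHS]mxE; apply: eq_bigr => k _.
by congr (_ * _); rewrite !mxE.
Qed.

Lemma frameK y : simg j y -> E y *m g a y *m (E y)^T = 1%:M.
Proof. exact: frame_orthonormal. Qed.

Lemma frame_expand y v : simg j y ->
  v = \sum_p inner g a y v (row p (E y)) *: row p (E y).
Proof.
move=> Uy; rewrite -[LHS]mulmx1 -(frame_ginv frameK Uy) !mulmxA.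
rewrite [LHS]mulmx_sum_row; apply: eq_bigr => p _.
by rewrite inner_row.
Qed.

Lemma form_eval_suml y (w : 'I_n -> R) u x z :
  form_eval T a y (\sum_p w p *: u p) x z = \sum_p w p * form_eval T a y (u p) x z.
Proof.
rewrite /form_eval; under [RHS]eq_bigr do rewrite mulr_sumr.
rewrite [RHS]exchange_big; apply: eq_bigr => k _ /=.
under [RHS]eq_bigr do rewrite mulr_sumr.
rewrite [RHS]exchange_big; apply: eq_bigr => i _ /=.
under [RHS]eq_bigr do rewrite mulr_sumr.
rewrite [RHS]exchange_big; apply: eq_bigr => l _ /=.
rewrite summxE mulr_sumr !mulr_suml; apply: eq_bigr => p _; rewrite mxE; ring.
Qed.

Lemma vec_cdotE y v psi : vec_cdot j y v psi =
  (\sum_p rc (inner g a y v (row p (E y))) *: c p) *m psi.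
Proof. by []. Qed.

Lemma contr_cdotE y v psi : simg j y -> contr_cdot T j y v psi =
  (\sum_p rc (inner g a y v (row p (E y))) *: clif2 c (tfr y p)) *m psi.
Proof.
move=> Uy; rewrite /contr_cdot; congr (_ *m _).
pose B p : 'M[R]_n := \matrix_(q, r) tfr y p q r.
have e p : clif2 c (tfr y p) = clif2 c (fun q r => B p q r).
  by do 2 (apply: eq_bigr => ? _); rewrite mxE.
under [RHS]eq_bigr do rewrite e -clif2Z.
rewrite -clif2_mxsum.
do 2 (apply: eq_bigr => ? _); congr (rc _ *: _).
rewrite {1}(frame_expand v Uy) form_eval_suml summxE; apply: eq_bigr => p _.
by rewrite !mxE form_evalE.
Qed.


Lemma form_cdotE y psi : form_cdot T j y psi = clif3 c (tfr y) *m psi.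
Proof.
rewrite /form_cdot; congr (_ *m _).
by do 3 (apply: eq_bigr => ? _); rewrite form_evalE.
Qed.

Lemma vec_cdot_frame y p psi : simg j y ->
  vec_cdot j y (row p (E y)) psi = c p *m psi.
Proof.
move=> Uy; rewrite vec_cdotE; congr (_ *m _); rewrite (bigD1 p) //= big1.
  rewrite inner_row -!row_mul frameK // !mxE eqxx addr0.
  by rewrite rmorph1 scale1r.
move=> q /negbTE qp; rewrite inner_row -!row_mul frameK // !mxE eq_sym qp.
by rewrite rmorph0 scale0r.
Qed.

Lemma contr_cdot_frame y p psi :
  contr_cdot T j y (row p (E y)) psi = clif2 c (tfr y p) *m psi.
Proof.
rewrite /contr_cdot; congr (_ *m _).
by do 2 (apply: eq_bigr => ? _); rewrite form_evalE.
Qed.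

Lemma gamma_mx_sym : torsion_free D -> forall z, simg j z ->
  forall k i l, gamma_mx k z i l = gamma_mx i z k l.
Proof. by move=> h z Uz k i l; rewrite !mxE h //; exact: simg_cimg. Qed.

Lemma gamma_mx_compat : metric_compatible g D -> forall z, simg j z ->
  forall k, pd (g a) k z = gamma_mx k z *m g a z + g a z *m (gamma_mx k z)^T.
Proof.
move=> h z Uz k; apply/matrixP => i l; rewrite mxE h; last exact: simg_cimg.
rewrite !mxE; congr (_ + _); apply: eq_bigr => m _; first by rewrite mxE.
by rewrite !mxE mulrC.
Qed.

Lemma form_mx12 z : simg j z -> forall k i l, form_mx k z i l = - form_mx i z k l.
Proof. by move=> Uz k i l; rewrite !mxE form_alt12 //; exact: simg_cimg. Qed.

Lemma form_mx23 z : simg j z -> forall k i l, form_mx k z i l = - form_mx k z l i.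
Proof. by move=> Uz k i l; rewrite !mxE form_alt23 //; exact: simg_cimg. Qed.

Lemma ginv_metric z : simg j z -> invmx (g a z) = ginv E z.
Proof.
move=> Uz; have h := frame_ginvl frameK Uz.
have [_ gu] := mulmx1_unit h.
by rewrite -[LHS]mul1mx -h mulmxK.
Qed.

Lemma torsion_vector_delta z k i l : simg j z ->
  torsion_vector g T a z (delta_mx 0 k) (delta_mx 0 i) 0 l =
  (form_mx k z *m ginv E z) i l.
Proof.
move=> Uz; rewrite /torsion_vector ginv_metric // mxE [RHS]mxE.
apply: eq_bigr => m _; congr (_ * _); rewrite mxE /form_eval.
rewrite (bigD1 k) //= [X in _ + X]big1 ?addr0; last first.
  move=> q qk; rewrite big1 // => s _; rewrite big1 // => r _.
  by rewrite !mxE (negbTE qk) andbF mulr0 !mul0r.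
rewrite (bigD1 i) //= [X in _ + X]big1 ?addr0; last first.
  move=> q qk; rewrite big1 // => s _.
  by rewrite !mxE (negbTE qk) andbF mulr0 !mul0r.
rewrite (bigD1 m) //= [X in _ + X]big1 ?addr0; last first.
  by move=> q qk; rewrite !mxE (negbTE qk) andbF mulr0.
by rewrite !mxE !eqxx /= !mulr1.
Qed.

Local Notation GC := (GamC E gamma_mx form_mx).

Lemma christoffel_cE z k i l : simg j z ->
  christoffel_c g D T a z k i l = GC k z i l.
Proof.
move=> Uz; rewrite /christoffel_c torsion_vector_delta // /GamC mx_add mx_scale.
by rewrite [gamma_mx _ _ _ _]mxE.
Qed.

Lemma form_mx_parallel :
  (forall y, cimg a y -> forall l p q r, nabla_c_form g D T a y l p q r = 0) ->
  forall z, simg j z -> forall l k, pd (form_mx k) l z =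
    \sum_m GC l z k m *: form_mx m z
    + (GC l z *m form_mx k z + form_mx k z *m (GC l z)^T).
Proof.
move=> h z Uz l k; apply/matrixP => q r.
have := h z (simg_cimg Uz) l k q r; rewrite /nabla_c_form => /eqP.
rewrite subr_eq0 => /eqP hp; rewrite mxE.
under [X in partial l X z = _]eq_fun do rewrite mxE.
rewrite hp 2!mx_add summxE [X in _ + (X + _)]mxE [X in _ + (_ + X)]mxE.
rewrite -!big_split; apply: eq_bigr => m _ /=.
rewrite !christoffel_cE // mx_scale [(GC l z)^T _ _]mxE.
by rewrite ![form_mx _ _ _ _]mxE [_ * GC l z r m]mulrC addrA.
Qed.

Lemma scalE z : simg j z -> scal g D a z = frame_scalar E gamma_mx z.
Proof.
move=> Uz; rewrite /scal /frame_scalar; apply: eq_bigr => p _.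
apply: eq_bigr => k _; rewrite ginv_metric //; congr (_ * _).
apply: eq_bigr => i _; rewrite /curvature /curv !mx_add mx_opp.
rewrite [pd (gamma_mx p) i z _ _]mxE [pd (gamma_mx i) p z _ _]mxE; congr (_ - _ + _).
- by congr (partial _ _ _); apply/funext => x; rewrite mxE.
- by congr (partial _ _ _); apply/funext => x; rewrite mxE.
by rewrite mx_opp !mxE -sumrB; apply: eq_bigr => m _; rewrite !mxE.
Qed.

Lemma form_normsqE z : simg j z ->
  form_normsq T j z = frame_normsq E form_mx z / 6.
Proof.
move=> Uz.
have delta3 u v l : form_eval T a z u v (delta_mx 0 l) =
    \sum_p \sum_q T a z p q l * u 0 p * v 0 q.
  apply: eq_bigr => p _; apply: eq_bigr => q _.
  rewrite (bigD1 l) //= [X in _ + X]big1 ?addr0; last first.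
    by move=> r rl; rewrite mxE (negbTE rl) andbF mulr0.
  by rewrite mxE !eqxx mulr1.
have tE p q : torsion_vector g T a z (row p (E z)) (row q (E z)) =
   (\row_r tfr z p q r) *m E z.
  rewrite /torsion_vector ginv_metric // /ginv mulmxA; congr (_ *m _).
  apply/rowP => r; rewrite [LHS]mxE [RHS]mxE -form_evalE {2}/form_eval.
  under eq_bigr do rewrite mxE delta3 mulr_suml.
  under eq_bigr do under eq_bigr do rewrite mulr_suml.
  rewrite -exchange_big3; apply: eq_bigr => p' _; apply: eq_bigr => q' _.
  by apply: eq_bigr => l _; rewrite !mxE.
have iE p q : inner g a z (torsion_vector g T a z (row p (E z)) (row q (E z)))
    (torsion_vector g T a z (row p (E z)) (row q (E z))) =
    \sum_r tfr z p q r ^+ 2.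
  rewrite tE /inner trmx_mul !mulmxA -(mulmxA _ (E z)) -(mulmxA _ _ (E z)^T).
  rewrite frameK // mulmx1 mxE; apply: eq_bigr => r _.
  by rewrite !mxE.
rewrite /form_normsq; under eq_bigr do under eq_bigr do rewrite iE.
rewrite /frame_normsq sum_lt2 => [|p q|p].
- by rewrite mulr2n; move: (\sum_(p < n) _) => x; field.
- apply: eq_bigr => r _.
  by rewrite (frame_form12 E (fun x (Ux : simg j x) => form_mx12 Ux) p q r Uz) sqrrN.
rewrite big1 // => r _.
have := frame_form12 E (fun x (Ux : simg j x) => form_mx12 Ux) p p r Uz.
by move=> h; have -> : tfr z p p r = 0; [lra|rewrite expr0n].
Qed.


Lemma spinor_deriv_cpd z v : spinor_deriv phi0 j z v = cpd (phi0 j) v z.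
Proof. by apply/matrixP => k i; rewrite !mxE ord1. Qed.

Lemma cpd_spinor : (forall y v, simg j y -> nabla_c D T phi0 j y v = 0) ->
  forall z, simg j z -> forall k, cpd (phi0 j) (delta_mx 0 k) z = - 2^-1 *:
    (clif2 c (fun p q => spin_conn E (g a) gamma_mx form_mx k z p q) *m phi0 j z).
Proof.
move=> h z Uz k; have /eqP := h z (delta_mx 0 k) Uz.
rewrite /nabla_c /nabla_g spinor_deriv_cpd -addrA addr_eq0 => /eqP ->.
have covE p : cov_deriv D a (fun x => row p (E x)) z (delta_mx 0 k) =
    row p (pd E k z + E z *m gamma_mx k z).
  apply/rowP => l; rewrite [LHS]mxE [RHS]mxE mx_add; congr (_ + _).
    by rewrite mxE; congr (partial _ _ _); apply/funext => x; rewrite mxE.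
  rewrite (bigD1 k) //= [X in _ + X]big1 ?addr0; last first.
    by move=> i ik; rewrite big1 // => r _; rewrite !mxE (negbTE ik) andbF !mul0r.
  by rewrite [RHS]mxE; apply: eq_bigr => r _; rewrite !mxE !eqxx mul1r.
have -> : clif2 c (fun p q => inner g a z
    (cov_deriv D a (fun x => row p (E x)) z (delta_mx 0 k)) (row q (E z)))
  = clif2 c (fun p q => ((pd E k z + E z *m gamma_mx k z) *m g a z *m (E z)^T) p q).
  do 2 (apply: eq_bigr => ? _); rewrite inner_row covE -!row_mul.
  by rewrite [in LHS]mxE.
have -> : contr_cdot T j z (delta_mx 0 k) (phi0 j z) =
  clif2 c (fun p q => (E z *m form_mx k z *m (E z)^T) p q) *m phi0 j z.
  by rewrite /contr_cdot; congr (_ *m _); do 2 (apply: eq_bigr => ? _);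
    rewrite form_eval_delta.
rewrite /spin_conn clif2D clif2Z; exact: half_quarter.
Qed.


(** The 2-form e_b _| T in chart components. Only one slot is moved to the frame, so that a sum over
    b replaces a contraction with the inverse metric. *)
Let B z b : 'M[R]_n := \sum_i E z b i *: form_mx i z.

Lemma frame_form_mx z b p q : tfr z b p q =
  \sum_p' \sum_q' B z b p' q' * E z p p' * E z q q'.
Proof.
have -> : tfr z b = E z *m B z b *m (E z)^T.
  rewrite /B mulmx_sumr mulmx_suml; apply: eq_bigr => i _.
  by rewrite -scalemxAr -scalemxAl.
rewrite mxE exchange_big; apply: eq_bigr => q' _ /=.
rewrite [(E z *m _) _ _]mxE mulr_suml; apply: eq_bigr => p' _.
by rewrite [(E z)^T _ _]mxE; ring.
Qed.

Lemma frame_pair z p q r s :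
  \sum_p' \sum_q' \sum_r' \sum_s' (\sum_b B z b p' q' * B z b r' s')
    * E z p p' * E z q q' * E z r r' * E z s s' =
  \sum_b tfr z b p q * tfr z b r s.
Proof.
transitivity (\sum_b \sum_p' \sum_q' \sum_r' \sum_s'
    (B z b p' q' * E z p p' * E z q q') * (B z b r' s' * E z r r' * E z s s')).
  rewrite [RHS]exchange_big; apply: eq_bigr => p' _ /=.
  rewrite -exchange_big4; apply: eq_bigr => q' _; apply: eq_bigr => r' _.
  apply: eq_bigr => s' _; rewrite !mulr_suml; apply: eq_bigr => b _; ring.
apply: eq_bigr => b _; rewrite !frame_form_mx mulr_suml; apply: eq_bigr => p' _.
rewrite mulr_suml; apply: eq_bigr => q' _; rewrite mulr_sumr.
by apply: eq_bigr => r' _; rewrite mulr_sumr.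
Qed.

(** The part of the connection that is skew in its lower indices is the torsion, so the difference
    is g(T(d_p, d_q), T(d_r, d_s)), with the inverse metric resolved along the frame. *)
Lemma torsion_pair z p q r s : torsion_free D -> simg j z ->
  \sum_m GC p z q m * form_mx m z r s - \sum_m GC q z p m * form_mx m z r s
  = \sum_b B z b p q * B z b r s.
Proof.
move=> hD Uz; rewrite -sumrB.
transitivity (\sum_m (\sum_b B z b p q * E z b m) * form_mx m z r s).
  apply: eq_bigr => m _; rewrite -mulrBl; congr (_ * _).
  have e k i : (form_mx k z *m ginv E z) i m = \sum_b B z b k i * E z b m.
    rewrite /ginv mulmxA mxE; apply: eq_bigr => b _; congr (_ * _).
    rewrite mxE /B summxE; apply: eq_bigr => l _.
    rewrite mx_scale [(E z)^T _ _]mxE (form_mx23 Uz k) (form_mx12 Uz k l i); ring.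
  rewrite /GamC !mx_add !mx_scale !e (gamma_mx_sym hD Uz p).
  have -> : \sum_b B z b q p * E z b m = - \sum_b B z b p q * E z b m.
    rewrite -sumrN; apply: eq_bigr => b _; rewrite -mulNr; congr (_ * _).
    rewrite /B !summxE -sumrN; apply: eq_bigr => l _.
    by rewrite !mx_scale (form_mx23 Uz l q p) mulrN.
  by move: (\sum_b _) => x; lra.
under eq_bigr do rewrite mulr_suml.
rewrite exchange_big; apply: eq_bigr => b _ /=.
have -> : B z b r s = \sum_m E z b m * form_mx m z r s.
  by rewrite /B summxE; apply: eq_bigr => m _; rewrite mx_scale.
rewrite mulr_sumr; apply: eq_bigr => m _; exact: esym (mulrA _ _ _).
Qed.

(** Parallelism turns the four derivatives in dT into twelve connection terms. They group into six
    differences, one for each pair of indices, and complementary pairs give equal torsion products;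
    hence the factor 2. *)
Lemma ext_d_pair z p q r s : torsion_free D ->
  (forall y, cimg a y -> forall l p q r, nabla_c_form g D T a y l p q r = 0) ->
  simg j z -> ext_d T a z p q r s =
  2 * (\sum_b B z b p q * B z b r s - \sum_b B z b p r * B z b q s
       + \sum_b B z b p s * B z b q r).
Proof.
move=> hD hT Uz.
pose Q l p q r := \sum_m GC l z p m * form_mx m z q r.
have dT l p' q' r' : partial l (fun x => T a x p' q' r') z =
    Q l p' q' r' - Q l q' p' r' + Q l r' p' q'.
  have := hT z (simg_cimg Uz) l p' q' r'; rewrite /nabla_c_form => /eqP.
  rewrite subr_eq0 => /eqP ->; rewrite /Q -sumrB -big_split.
  apply: eq_bigr => m _ /=; rewrite !christoffel_cE // !mxE.
  have cz := simg_cimg Uz.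
  rewrite (form_alt12 T cz p' m r') (form_alt23 T cz p' q' m) (form_alt12 T cz p' m q').
  ring.
have tp l p' q' r' : Q l p' q' r' = Q p' l q' r' + \sum_b B z b l p' * B z b q' r'.
  by rewrite -(torsion_pair l p' q' r' hD Uz) addrC subrK.
have sC (x y : 'I_n -> R) : \sum_b x b * y b = \sum_b y b * x b.
  by apply: eq_bigr => b _; rewrite mulrC.
rewrite /ext_d !dT (tp p q) (tp p r) (tp p s) (tp q r) (tp q s) (tp r s).
rewrite (sC (fun b => B z b q r)) (sC (fun b => B z b q s)) (sC (fun b => B z b r s)).
ring.
Qed.

Lemma ext_d_cdotE z psi : torsion_free D ->
  (forall y, cimg a y -> forall l p q r, nabla_c_form g D T a y l p q r = 0) ->
  simg j z -> ext_d_cdot T j z psi =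
  clif4 c (fun p q r s => 2 * (\sum_b tfr z b p q * tfr z b r s
    - \sum_b tfr z b p r * tfr z b q s + \sum_b tfr z b p s * tfr z b q r)) *m psi.
Proof.
move=> hD hT Uz; rewrite /ext_d_cdot; congr (_ *m _).
apply: eq_bigr => p _; apply: eq_bigr => q _; apply: eq_bigr => r _.
apply: eq_bigr => s _; congr (rc _ *: _).
rewrite -!frame_pair.
rewrite [X in _ - X + _](eq_bigr _ (fun p' _ => exchange_big _ _ _ _ _ _)).
rewrite [X in _ - _ + X](eq_bigr _ (fun p' _ => esym (exchange_big3 _))).
rewrite -sumrB -big_split mulr_sumr; apply: eq_bigr => p' _ /=.
rewrite -sumrB -big_split mulr_sumr; apply: eq_bigr => q' _ /=.
rewrite -sumrB -big_split mulr_sumr; apply: eq_bigr => r' _ /=.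
rewrite -sumrB -big_split mulr_sumr; apply: eq_bigr => s' _ /=.
rewrite ext_d_pair //; ring.
Qed.

End Bridge.

(** * Zeros of a parallel spinor *)

Section Nonvanishing.
Variables (R : realType) (n : nat) (M : topologicalType).
Variables (X : smooth_manifold R n M) (g : riemannian_metric X).
Variables (T : three_form X) (D : connection X) (c : clifford_rep R n).
Variables (P : spin_structure g c) (phi0 : spinor_field P).
Hypothesis hphipar : forall j y v, simg j y -> nabla_c D T phi0 j y v = 0.

Lemma spinor_csmoothmx (j : strv P) : csmoothmx (simg j) (phi0 j).
Proof. by move=> p q; rewrite ord1; exact: spinor_smooth. Qed.

Lemma normsq_parallel (j : strv P) y v : simg j y ->
  is_derive y v (fun z => normsq (phi0 j z)) 0.
Proof.
move=> Uy.
have := hphipar v Uy; rewrite /nabla_c /nabla_g spinor_deriv_cpd /contr_cdot.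
set A := clif2 c _; set B := clif2 c _ => /eqP.
rewrite -addrA addr_eq0 => /eqP h.
apply: (@normsq_derive _ _ _ (phi0 j) v y (- ((2^-1)%:C%C *: A + (4^-1)%:C%C *: B))).
  by rewrite adjN adjD !adjZ !adj_clif2 !scalerN -opprD.
have -> : - ((2^-1)%:C%C *: A + (4^-1)%:C%C *: B) *m phi0 j y = cpd (phi0 j) v y.
  by rewrite h mulNmx mulmxDl -!scalemxAl !fmorphV !rmorph_nat.
exact: cmd_cpd (spinor_csmoothmx j) Uy.
Qed.

Lemma coord_simg (j : strv P) x : sdom j x -> simg j (Defs.coord (schart j) x).
Proof.
move=> jx; have ax := sdom_chart jx.
by split; [exact: coord_img|rewrite coordK].
Qed.

Lemma normsq_near (j : strv P) x : sdom j x -> \forall x' \near x,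
  sdom j x' /\
  normsq (phi0 j (Defs.coord (schart j) x')) = normsq (phi0 j (Defs.coord (schart j) x)).
Proof.
move=> jx; have Uy := coord_simg jx; set y := Defs.coord (schart j) x in Uy *.
have : nbhs y (simg j) by apply: open_nbhs_nbhs; split => //; exact: simg_open.
case/nbhs_ballP => r /= r0 rU.
have n1 : nbhs x (Defs.coord (schart j) @^-1` ball y r).
  by apply: (Defs.coord_continuous (sdom_chart jx)); exact: nbhsx_ballx.
have n2 : nbhs x (sdom j) by apply: open_nbhs_nbhs; split => //; exact: sdom_open.
apply: filterS (filterI n1 n2) => x' [bx' jx']; split => //.
apply: (@derive0_ball _ _ (fun z => normsq (phi0 j z)) y r) => //.
by move=> v z /rU; exact: normsq_parallel.
Qed.

(** The set [N] of nonzero points and its complement are both open by [normsq_near]. Norms are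
    compared within one trivialisation; between trivialisations only zeros are transported, by
    linearity of the lift. *)
Lemma spinor_nonvanishing : connected [set: M] -> spinor_nontrivial phi0 ->
  forall (j : strv P) y, simg j y -> phi0 j y <> 0.
Proof.
move=> hconn [j0 [y0 [U0 phi00]]].
pose N := [set x : M | exists j, sdom j x /\ phi0 j (Defs.coord (schart j) x) <> 0].
have trans (j k : strv P) x : sdom j x -> sdom k x ->
    phi0 j (Defs.coord (schart j) x) = 0 -> phi0 k (Defs.coord (schart k) x) = 0.
  by move=> jx kx e; rewrite (spinor_trans phi0 kx jx) e mulmx0.
have norm0 m (p q : 'cV[R[i]]_m) : normsq p = normsq q -> p = 0 -> q = 0.
  move=> e p0; apply: normsq_eq0; rewrite -e p0 /normsq big1 // => k _.
  by rewrite !mxE /= expr0n addr0.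
have oN : open N.
  rewrite openE => x [j [jx nx]]; rewrite /interior.
  apply: filterS (normsq_near jx) => x' [jx' e]; exists j; split => //.
  by move=> h; apply: nx; apply: norm0 h.
have oNC : open (~` N).
  rewrite openE => x Nx; rewrite /interior.
  have [j jx] := sdom_cover P x.
  have phix : phi0 j (Defs.coord (schart j) x) = 0.
    by apply: contrapT => h; apply: Nx; exists j.
  apply: filterS (normsq_near jx) => x' [jx' e] [k [kx' nk]].
  by apply: nk; apply: trans jx' kx' _; apply: norm0 phix.
have NT : N = setT.
  apply: hconn.
  - exists (param (schart j0) y0), j0; have [cy sy] := U0; split => //.
    by rewrite paramK.
  - by exists N => //; rewrite setTI.
  - by exists N; [rewrite -[N]setCK; exact: open_closedC|rewrite setTI].
move=> j y Uy e; have [cy sy] := Uy.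
have : N (param (schart j) y) by rewrite NT.
move=> [k [kx nk]]; apply: nk; apply: trans sy kx _.
by rewrite paramK.
Qed.
End Nonvanishing.

(** * Reduction of the scalar conditions, with N = n, G = gamma^2, S = Scal^g, Q = 6 ||T||^2 *)

Section ScalarIdentities.
Variable R : realFieldType.
Implicit Types N G S Q : R.

(** After S = 2 G - Q / 12, clearing denominators makes the two equations proportional; the bound on
    N makes the denominator invertible. *)
Lemma scal_conditionP N G S Q : 3 <= N -> 2 * S = 4 * G - Q / 6 ->
  G = 4 * N / (9 * (N - 1)) * S <-> 3 * (9 - N) * G = N * Q.
Proof.
move=> N3 hS; have SE : S = 2 * G - Q / 12 by lra.
have N1 : N - 1 != 0 by apply: lt0r_neq0; lra.
have e : 9 * (N - 1) * (G - 4 * N / (9 * (N - 1)) * S) = 9 * (N - 1) * G - 4 * N * S.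
  by field.
rewrite SE in e *; split => h; first by move: e; rewrite -h subrr mulr0; lra.
have n9 : 9 * (N - 1) != 0 by rewrite mulf_neq0 // pnatr_eq0.
apply/eqP; rewrite -subr_eq0; apply/eqP; apply: (mulfI n9).
rewrite e mulr0; lra.
Qed.

Lemma twistor_conditionP N G Q : 3 <= N ->
  G + Q / 3 = 9 * G / N <-> 3 * (9 - N) * G = N * Q.
Proof.
move=> N3; have N0 : N != 0 by apply: lt0r_neq0; lra.
have e : N * (G + Q / 3 - 9 * G / N) = N * G + N * Q / 3 - 9 * G by field.
split => h; first by move: e; rewrite h subrr mulr0; lra.
apply/eqP; rewrite -subr_eq0; apply/eqP; apply: (mulfI N0).
rewrite e mulr0; lra.
Qed.

Lemma normsq_conditionP N G Q : N <= 8 ->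
  G = 2 * N / (9 - N) * (Q / 6) <-> 3 * (9 - N) * G = N * Q.
Proof.
move=> N8; have N9 : 9 - N != 0 by apply: lt0r_neq0; lra.
have e : (9 - N) * (G - 2 * N / (9 - N) * (Q / 6)) = (9 - N) * G - N * Q / 3.
  by field.
split => h; first by move: e; rewrite -h subrr mulr0; lra.
apply/eqP; rewrite -subr_eq0; apply/eqP; apply: (mulfI N9).
rewrite e mulr0; lra.
Qed.

Lemma scal_normsq_conditionP N G S Q : N <= 8 -> 2 * S = 4 * G - Q / 6 ->
  S = 9 * (N - 1) / (2 * (9 - N)) * (Q / 6) <-> 3 * (9 - N) * G = N * Q.
Proof.
move=> N8 hS; have SE : S = 2 * G - Q / 12 by lra.
have N9 : 9 - N != 0 by apply: lt0r_neq0; lra.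
have e : (9 - N) * (S - 9 * (N - 1) / (2 * (9 - N)) * (Q / 6)) =
    (9 - N) * S - 9 * (N - 1) * Q / 12 by field.
rewrite SE in e *; split => h; first by move: e; rewrite -h subrr mulr0; lra.
apply/eqP; rewrite -subr_eq0; apply/eqP; apply: (mulfI N9).
rewrite e mulr0; lra.
Qed.

Lemma dT_eigenvalue N G Q : 3 <= N -> 3 * (9 - N) * G = N * Q ->
  Q / 6 - G = - (3 * G * (N - 3) / (2 * N)).
Proof.
move=> N3 h; have N0 : N != 0 by apply: lt0r_neq0; lra.
have QE : Q = 3 * (9 - N) * G / N by rewrite h mulrC mulKf.
by rewrite QE; field.
Qed.
End ScalarIdentities.

Lemma killing_twistor (R : realType) m k (kappa : R) (A B : 'M[R[i]]_m)
    (x : 'M[R[i]]_(m, k)) :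
  - 4^-1 *: (A *m x) = kappa%:C%C *: (B *m x) ->
  (A + (4 * kappa)%:C%C *: B) *m x = 0.
Proof.
move=> h; rewrite mulmxDl -scalemxAl rmorphM rmorph_nat -scalerA -h.
by rewrite scalerA mulrN mulfV ?pnatr_eq0 // scaleN1r subrr.
Qed.

(** * The equivalences at one point *)

Section Pointwise.
Variables (R : realType) (n : nat) (M : topologicalType).
Variables (X : smooth_manifold R n M) (g : riemannian_metric X).
Variables (T : three_form X) (D : connection X) (c : clifford_rep R n).
Variables (P : spin_structure g c) (phi0 : spinor_field P) (gamma : R).
Hypothesis hn : (3 <= n)%N.
Hypothesis hD : levi_civita g D.
Hypothesis hTpar : forall (a : chart X) y, cimg a y ->
  forall l p q r, nabla_c_form g D T a y l p q r = 0.
Hypothesis hphipar : forall j y v, simg j y -> nabla_c D T phi0 j y v = 0.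
Hypothesis hTphi : forall j y, simg j y ->
  form_cdot T j y (phi0 j y) = gamma%:C%C *: phi0 j y.
Variables (j : strv P) (y : 'rV[R]_n).
Hypothesis Uy : simg j y.
Hypothesis phi_neq0 : phi0 j y <> 0.

Local Notation rc := (real_complex R).
Let t := frame_form (frame j) (form_mx T j) y.
Let Q := frame_normsq (frame j) (form_mx T j) y.
Let t12 p q r : t p q r = - t q p r.
Proof. exact: (frame_form12 _ (fun z (Uz : simg j z) => form_mx12 T Uz) p q r Uy). Qed.
Let t23 p q r : t p q r = - t p r q.
Proof. exact: (frame_form23 _ (fun z (Uz : simg j z) => form_mx23 T Uz) p q r Uy). Qed.
Let eigen : clif3 c t *m phi0 j y = rc gamma *: phi0 j y.
Proof. by rewrite -form_cdotE hTphi. Qed.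

Lemma parallel_scal :
  2 * scal g D (schart j) y = 4 * gamma ^+ 2 - Q / 6.
Proof.
rewrite scalE //; apply: (scal_eigen t12 t23 phi_neq0 eigen).
have [hD1 hD2] := hD.
exact: (parallel_scal_cliff (@simg_open _ _ _ _ _ _ P j) (frame_smoothmx j)
  (metric_smoothmx j) (gamma_smoothmx D j) (form_smoothmx T j)
  (@frameK _ _ _ _ _ _ P j) (@gamma_mx_sym _ _ _ _ _ _ _ P j hD1)
  (@gamma_mx_compat _ _ _ _ _ _ _ P j hD2) (@form_mx12 _ _ _ _ _ T _ P j)
  (@form_mx23 _ _ _ _ _ T _ P j)
  (@form_mx_parallel _ _ _ _ _ _ _ _ P j (@hTpar (schart j)))
  (spinor_csmoothmx phi0 j) (@cpd_spinor _ _ _ _ _ _ _ _ P phi0 j (@hphipar j)) Uy).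
Qed.


Let N3 : 3 <= n%:R :> R. Proof. by rewrite ler_nat. Qed.
Let n_gt0 : (0 < n)%N. Proof. exact: leq_trans hn. Qed.
Let key := 3 * (9 - n%:R) * gamma ^+ 2 = n%:R * Q.

Lemma scal_condition_at :
  gamma ^+ 2 = 4 * n%:R / (9 * (n%:R - 1)) * scal g D (schart j) y <-> key.
Proof. exact: scal_conditionP N3 parallel_scal. Qed.

Lemma nabla_g_contr v : nabla_g D phi0 j y v = - 4^-1 *: contr_cdot T j y v (phi0 j y).
Proof.
have /eqP := hphipar v Uy; rewrite /nabla_c addr_eq0 => /eqP ->.
by rewrite scaleNr.
Qed.

(** On frame vectors the Killing equation says that T_a + 4 kappa e_a kills the spinor. Contraction
    determines kappa, which makes the shift 4 kappa equal to 3 gamma / n, and then [twistor_eigen]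
    applies. *)
Lemma killing_at (kappa : R) :
  (forall v, nabla_g D phi0 j y v = rc kappa *: vec_cdot j y v (phi0 j y)) ->
  kappa = 3 * gamma / (4 * n%:R) /\ key.
Proof.
move=> h.
have tw a : (clif2 c (t a) + rc (4 * kappa) *: c a) *m phi0 j y = 0.
  have := h (row a (frame j y)); rewrite nabla_g_contr contr_cdot_frame.
  rewrite vec_cdot_frame //; exact: killing_twistor.
have kE := killing_number t12 t23 phi_neq0 eigen n_gt0 tw; split => //.
apply/(twistor_conditionP _ _ N3)/(twistor_eigen t12 t23 phi_neq0 eigen n_gt0) => a.
have nn : n%:R != 0 :> R by rewrite pnatr_eq0 -lt0n.
have -> : 3 * gamma / n%:R = 4 * kappa by rewrite kE; field.
exact: tw.
Qed.

Lemma contr_vec_at v : key ->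
  contr_cdot T j y v (phi0 j y)
    + rc (3 * gamma / n%:R) *: vec_cdot j y v (phi0 j y) = 0.
Proof.
move=> /(twistor_conditionP _ _ N3) /(twistor_eigen t12 t23 phi_neq0 eigen n_gt0) tw.
rewrite contr_cdotE // vec_cdotE scalemxAl -mulmxDl scaler_sumr -big_split.
rewrite mulmx_suml big1 // => a _ /=.
rewrite [rc (3 * gamma / n%:R) *: _]scalerA mulrC -scalerA -scalerDr -scalemxAl.
by rewrite tw scaler0.
Qed.

Lemma killing_of_key v : key -> nabla_g D phi0 j y v =
  rc (3 * gamma / (4 * n%:R)) *: vec_cdot j y v (phi0 j y).
Proof.
move=> k; have /eqP := contr_vec_at v k; rewrite addr_eq0 => /eqP e.
rewrite nabla_g_contr e scalerN scaleNr opprK scalerA; congr (_ *: _).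
have -> : 3 * gamma / (4 * n%:R) = 4^-1 * (3 * gamma / n%:R) :> R.
  by rewrite invfM; ring.
by rewrite [RHS]rmorphM fmorphV rmorph_nat.
Qed.

Lemma normsq_condition_at : (n <= 8)%N ->
  gamma ^+ 2 = 2 * n%:R / (9 - n%:R) * form_normsq T j y <-> key.
Proof.
move=> n8; rewrite form_normsqE //; apply: normsq_conditionP.
by rewrite ler_nat.
Qed.

Lemma scal_normsq_condition_at : (n <= 8)%N ->
  scal g D (schart j) y =
    9 * (n%:R - 1) / (2 * (9 - n%:R)) * form_normsq T j y <-> key.
Proof.
move=> n8; rewrite form_normsqE //; apply: scal_normsq_conditionP parallel_scal.
by rewrite ler_nat.
Qed.

Lemma ext_d_at : key -> ext_d_cdot T j y (phi0 j y) =
  rc (- (3 * gamma ^+ 2 * (n%:R - 3) / (2 * n%:R))) *: phi0 j y.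
Proof.
move=> k; rewrite (ext_d_cdotE _ hD.1 (@hTpar (schart j)) Uy).
by rewrite (clif4_eigen t12 t23 eigen) // (dT_eigenvalue N3 k).
Qed.

End Pointwise.

Theorem proposition3p2 (R : realType) (n : nat) (M : topologicalType)
  (X : smooth_manifold R n M) (g : riemannian_metric X) (T : three_form X)
  (D : connection X) (c : clifford_rep R n) (P : spin_structure g c)
  (phi0 : spinor_field P) (gamma : R)
  (hn : (3 <= n)%N)
  (hcompact : compact [set: M])
  (hconnected : connected [set: M])
  (hD : levi_civita g D)
  (hT : form_nontrivial T)
  (hTpar : forall a y, cimg a y ->
     forall l p q r, nabla_c_form g D T a y l p q r = 0)
  (hscal : forall (j : strv P) y, simg j y -> 0 < scal g D (schart j) y)
  (hphi : spinor_nontrivial phi0)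
  (hphipar : forall j y v, simg j y -> nabla_c D T phi0 j y v = 0)
  (hgamma : gamma != 0)
  (hTphi : forall j y, simg j y ->
     form_cdot T j y (phi0 j y) = gamma%:C%C *: phi0 j y) :
  let scal_condition := forall (j : strv P) y, simg j y ->
    gamma ^+ 2 = 4 * n%:R / (9 * (n%:R - 1)) * scal g D (schart j) y in
  [/\ (real_killing_spinor D phi0 <-> scal_condition),
      (scal_condition ->
         [/\ killing_spinor D (3 * gamma / (4 * n%:R)) phi0,
             (forall kappa : R, killing_spinor D kappa phi0 ->
                kappa = 3 * gamma / (4 * n%:R)) &
             forall j y v, simg j y ->
               contr_cdot T j y v (phi0 j y)
               + (3 * gamma / n%:R)%:C%C *: vec_cdot j y v (phi0 j y) = 0]) &
      ((n <= 8)%N ->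
         [/\ (scal_condition <->
                forall (j : strv P) y, simg j y ->
                  gamma ^+ 2 = 2 * n%:R / (9 - n%:R) * form_normsq T j y),
             (scal_condition <->
                forall (j : strv P) y, simg j y ->
                  scal g D (schart j) y =
                    9 * (n%:R - 1) / (2 * (9 - n%:R)) * form_normsq T j y) &
             (scal_condition ->
                forall j y, simg j y ->
                  ext_d_cdot T j y (phi0 j y) =
                    (- (3 * gamma ^+ 2 * (n%:R - 3) / (2 * n%:R)))%:C%C
                      *: phi0 j y)])].
Proof.
move=> scal_condition.
have nz : forall (j : strv P) y, simg j y -> phi0 j y <> 0.
  exact: spinor_nonvanishing hphipar hconnected hphi.
(* The Killing number is read off at one point of one trivialisation; nontriviality of the spinor
   supplies it. *)
have [j0 [y0 [U0 _]]] := hphi.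
have n0 : n%:R != 0 :> R by rewrite pnatr_eq0; case: (n) hn.
pose key (j : strv P) y := 3 * (9 - n%:R) * gamma ^+ 2 =
  n%:R * frame_normsq (frame j) (form_mx T j) y.
have condP : scal_condition <-> forall j y, simg j y -> key j y.
  split=> h j y Uy.
    exact/(scal_condition_at hn hD hTpar hphipar hTphi Uy (nz _ _ Uy))/h.
  exact/(scal_condition_at hn hD hTpar hphipar hTphi Uy (nz _ _ Uy))/h.
have killP kappa : killing_spinor D kappa phi0 ->
    forall j y, simg j y -> kappa = 3 * gamma / (4 * n%:R) /\ key j y.
  move=> [_ h] j y Uy.
  apply: (killing_at hn hphipar hTphi Uy (nz _ _ Uy)) => v; exact: h.
have kill_of : scal_condition -> killing_spinor D (3 * gamma / (4 * n%:R)) phi0.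
  move=> /condP h; split.
    apply: mulf_neq0; first by rewrite mulf_neq0 // pnatr_eq0.
    by rewrite invr_eq0 mulf_neq0 // pnatr_eq0.
  move=> j y v Uy; exact: (killing_of_key hn hphipar hTphi Uy (nz _ _ Uy) v (h j y Uy)).
split.
- split=> [[kappa /killP h]|h]; last by eexists; exact: kill_of h.
  by apply/condP => j y Uy; have [] := h j y Uy.
- move=> h; split; first exact: kill_of.
    by move=> kappa /killP/(_ j0 y0 U0)[].
  move=> j y v Uy.
  exact: (contr_vec_at hn hTphi Uy (nz _ _ Uy) v (condP.1 h j y Uy)).
move=> n8; split.
- split=> [/condP h|h]; last apply/condP => j y Uy.
    move=> j y Uy; exact/(normsq_condition_at T gamma Uy n8)/h.
  exact/(normsq_condition_at T gamma Uy n8)/h.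
- split=> [/condP h|h]; last apply/condP => j y Uy.
    move=> j y Uy.
    exact/(scal_normsq_condition_at hD hTpar hphipar hTphi Uy (nz _ _ Uy) n8)/h.
  exact/(scal_normsq_condition_at hD hTpar hphipar hTphi Uy (nz _ _ Uy) n8)/h.
move=> /condP h j y Uy.
exact: (ext_d_at hn hD hTpar hTphi Uy (h j y Uy)).
Qed.
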